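(* Let $(M,\varphi_i,\xi_i,\eta_i,g)$, $i=1,2,3$, be an almost $3$-contact metric manifold and $\varphi$ an almost contact metric structure in the associated sphere $\Sigma_M$. Assume that (i) the tensor field $N_\varphi$ is skew-symmetric on $\mathcal H$; (ii) each $\xi_i$ is a Killing vector field. Let $\delta$ be the Reeb commutator function of $M$. Then $M$ admits $\varphi$-compatible connections. If $\nabla$ is any $\varphi$-compatible connection with torsion $T$ and parameter function $\gamma=T(\xi_1,\xi_2,\xi_3)$, the following hold: 1) for every vector field $X$ and every even permutation $(i,j,k)$ of $(1,2,3)$, $$\nabla_X\xi_i=\frac{2\delta+\gamma}{2}\,(\eta_k(X)\xi_j-\eta_j(X)\xi_k);$$ 2) for every $i=1,2,3$ and every $X,Y\in\Gamma(\mathcal H)$, $$g((\nabla_{\xi_i}\varphi)X,Y)=g((\mathcal L_{\xi_i}\varphi)X,Y)+d\eta_i(\varphi X,Y)+d\eta_i(X,\varphi Y).$$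
   Context: An almost contact metric structure $(\varphi,\xi,\eta,g)$ consists of a $(1,1)$-tensor field $\varphi$, a vector field $\xi$, a $1$-form $\eta$ and a Riemannian metric $g$ with $\varphi^2=-I+\eta\otimes\xi$, $\eta(\xi)=1$, $g(\varphi X,\varphi Y)=g(X,Y)-\eta(X)\eta(Y)$. $N_\varphi(X,Y)=[\varphi X,\varphi Y]+\varphi^2[X,Y]-\varphi[\varphi X,Y]-\varphi[X,\varphi Y]+d\eta(X,Y)\xi$, $N_\varphi(X,Y,Z)=g(N_\varphi(X,Y),Z)$. An almost $3$-contact metric manifold $(M,\varphi_i,\xi_i,\eta_i,g)$, $i=1,2,3$, is a manifold of dimension $4n+3$ with three almost contact metric structures with the same $g$ such that, for every even permutation $(i,j,k)$ of $(1,2,3)$, $\varphi_k=\varphi_i\varphi_j-\eta_j\otimes\xi_i=-\varphi_j\varphi_i+\eta_i\otimes\xi_j$, $\xi_k=\varphi_i\xi_j=-\varphi_j\xi_i$, $\eta_k=\eta_i\circ\varphi_j=-\eta_j\circ\varphi_i$. Set $\mathcal H=\bigcap_i\ker\eta_i$, $\mathcal V=\langle\xi_1,\xi_2,\xi_3\rangle$, so $TM=\mathcal H\oplus\mathcal V$. The associated sphere $\Sigma_M$ consists of all almost contact metric structures $\varphi_a=\sum a_i\varphi_i$, $\xi_a=\sum a_i\xi_i$, $\eta_a=\sum a_i\eta_i$ with $a\in S^2\subset\mathbb R^3$ (and metric $g$). $N_\varphi$ is skew-symmetric on $\mathcal H$ if $N_\varphi(X,Y,Z)$, restricted to $X,Y,Z\in\Gamma(\mathcal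 H)$, is a $3$-form on $\mathcal H$. The Reeb commutator function is the function $\delta\in C^\infty(M)$ with $\eta_k([\xi_i,\xi_j])=2\delta\epsilon_{ijk}$ for all $i,j,k=1,2,3$ ($\epsilon_{ijk}$ the totally skew-symmetric symbol); it exists whenever all $\xi_i$ are Killing. A metric connection $\nabla$ has skew torsion if $T(X,Y,Z)=g(T(X,Y),Z)$ is a $3$-form. For $\varphi\in\Sigma_M$, a $\varphi$-compatible connection is a metric connection with skew torsion that preserves the splitting $TM=\mathcal H\oplus\mathcal V$ and satisfies $(\nabla_X\varphi)Y=0$ for all $X,Y\in\Gamma(\mathcal H)$. Convention: $d\eta(X,Y)=X(\eta(Y))-Y(\eta(X))-\eta([X,Y])$. *)

(* Defs.v *)
From HB Require Import structures.
From mathcomp Require Export all_boot all_order all_algebra all_fingroup.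
From mathcomp Require Export boolp classical_sets functions cardinality reals.
From mathcomp Require Export topology normedtype derive.
From mathcomp Require Import ring.
Set Implicit Arguments.
Unset Strict Implicit.
Unset Printing Implicit Defensive.
Export Order.TTheory GRing.Theory Num.Theory.
Export numFieldNormedType.Exports.
Local Open Scope classical_set_scope.
Local Open Scope ring_scope.

Section SmoothFunctionsOnOpenSets.
Context {R : realType} {m : nat}.
Implicit Types (U : set 'rV[R]_m) (f g : 'rV[R]_m -> R).

(* C^k on an open set U through iterated partial derivatives. Only the values
   of f on U matter when U is open. *)
Fixpoint Ck_on (k : nat) U f : Prop :=
  (forall x, U x -> {for x, continuous f}) /\
  if k is k'.+1 then
    forall i : 'I_m,
      (forall x, U x -> derivable f x (delta_mx 0 i)) /\
      Ck_on k' U (fun x => 'D_(delta_mx 0 i) f x)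
  else True.

Definition smooth_on U f := forall k, Ck_on k U f.

Lemma Ck_onW k U f : Ck_on k.+1 U f -> Ck_on k U f.
Proof.
elim: k f => [|k IH] f [cf df]; split=> // i.
have [d1 d2] := df i; split=> //; exact: IH.
Qed.

Lemma near_open_eq U f g x : open U -> (forall y, U y -> f y = g y) -> U x ->
  \forall y \near x, f y = g y.
Proof.
move=> oU fg Ux; near=> y; apply: fg; near: y; exact: open_nbhs_nbhs.
Unshelve. all: by end_near. Qed.

Lemma continuous_open_eq U f g x : open U -> (forall y, U y -> f y = g y) ->
  U x -> {for x, continuous f} -> {for x, continuous g}.
Proof.
move=> oU fg Ux; rewrite /prop_for /continuous_at -(fg _ Ux).
apply: cvg_trans; apply: (@near_eq_cvg _ _ (nbhs x)).
exact: near_open_eq oU fg Ux.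
Qed.

Lemma Ck_on_eq k U f g : open U -> (forall x, U x -> f x = g x) ->
  Ck_on k U f -> Ck_on k U g.
Proof.
move=> oU; elim: k f g => [|k IH] f g fg [cf df]; split=> //;
  try by move=> x Ux; exact: continuous_open_eq fg Ux (cf x Ux).
move=> i; have [d1 d2] := df i; split.
  by move=> x Ux; apply: near_eq_derivable (d1 x Ux);
     exact: near_open_eq fg Ux.
by apply: IH d2 => x Ux; apply: near_eq_derive; exact: near_open_eq fg Ux.
Qed.

Lemma Ck_on_cst k U c : Ck_on k U (cst c).
Proof.
elim: k c => [|k IH] c; split=> //; try by move=> x _; exact: cst_continuous.
move=> i; split=> [x _|]; first exact: derivable_cst.
rewrite (_ : (fun x => _) = cst 0) //.
by apply/funext => x; rewrite derive_cst.
Qed.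

Lemma Ck_onD k U f g : open U ->
  Ck_on k U f -> Ck_on k U g -> Ck_on k U (f + g).
Proof.
move=> oU; elim: k f g => [|k IH] f g [cf df] [cg dg]; split=> //;
  try by move=> x Ux; apply: continuousD; [exact: cf|exact: cg].
move=> i; have [f1 f2] := df i; have [g1 g2] := dg i; split.
  by move=> x Ux; apply: derivableD; [exact: f1|exact: g1].
apply: (Ck_on_eq oU _ (IH _ _ f2 g2)) => x Ux.
by rewrite deriveD //; [exact: f1|exact: g1].
Qed.

Lemma Ck_onM k U f g : open U ->
  Ck_on k U f -> Ck_on k U g -> Ck_on k U (f * g).
Proof.
move=> oU; elim: k f g => [|k IH] f g hf hg.
all: have [cf df] := hf; have [cg dg] := hg; split=> //;
  try by move=> x Ux; apply: continuousM; [exact: cf|exact: cg].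
move=> i; have [f1 f2] := df i; have [g1 g2] := dg i; split.
  by move=> x Ux; apply: derivableM; [exact: f1|exact: g1].
have fk := Ck_onW hf; have gk := Ck_onW hg.
apply: (Ck_on_eq oU _ (Ck_onD oU (IH _ _ fk g2) (IH _ _ gk f2))) => x Ux.
by rewrite deriveM //; [exact: f1|exact: g1].
Qed.

End SmoothFunctionsOnOpenSets.

(* A chart is a homeomorphism from an open set of M onto an open set of R^m,
   given by two total functions of which only the values on these open sets
   are constrained. *)
Record chart (R : realType) (m : nat) (M : topologicalType) := Chart {
  chart_dom : set M;
  chart_img : set 'rV[R]_m;
  chart_map : M -> 'rV[R]_m;
  chart_inv : 'rV[R]_m -> M;
  chart_dom_open : open chart_dom;
  chart_img_open : open chart_img;
  chart_map_img : forall p, chart_dom p -> chart_img (chart_map p);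
  chart_inv_dom : forall x, chart_img x -> chart_dom (chart_inv x);
  chart_mapK : forall p, chart_dom p -> chart_inv (chart_map p) = p;
  chart_invK : forall x, chart_img x -> chart_map (chart_inv x) = x;
  chart_map_continuous :
    forall p, chart_dom p -> {for p, continuous chart_map};
  chart_inv_continuous :
    forall x, chart_img x -> {for x, continuous chart_inv} }.

Arguments chart_dom_open {R m M} c.
Arguments chart_img_open {R m M} c.

(* The atlas need not be maximal: it determines the smooth functions. *)
Record smooth_manifold (R : realType) (m : nat) := SmoothManifold {
  manifold_carrier :> topologicalType;
  manifold_hausdorff : hausdorff_space manifold_carrier;
  manifold_second_countable : @second_countable manifold_carrier;
  atlas : set (chart R m manifold_carrier);
  atlas_cover : forall p, exists2 c, atlas c & chart_dom c p;
  atlas_compatible : forall c d, atlas c -> atlas d ->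
    forall i : 'I_m,
      smooth_on (chart_img c `&` chart_inv c @^-1` chart_dom d)
                (fun x => chart_map d (chart_inv c x) 0 i) }.

Section SmoothFunctions.
Context {R : realType} {m : nat} (M : smooth_manifold R m).

Definition smooth (f : M -> R) :=
  forall c, atlas c -> smooth_on (chart_img c) (f \o chart_inv c).

Definition smooth_pred : {pred M -> R} := fun f => `[< smooth f >].

Fact smooth_subring_closed : subring_closed smooth_pred.
Proof.
have N1 : smooth (cst (-1)) by move=> c _ k; exact: Ck_on_cst.
split=> [|f g /asboolP sf /asboolP sg|f g /asboolP sf /asboolP sg].
- by apply/asboolP => c _ k; exact: Ck_on_cst.
- apply/asboolP => c ac k.
  have o := chart_img_open c.
  have := Ck_onD o (sf c ac k) (Ck_onM o (N1 c ac k) (sg c ac k)).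
  apply: Ck_on_eq => // x _; rewrite !fctE /= mulN1r //.
- by apply/asboolP => c ac k; apply: Ck_onM (sf c ac k) (sg c ac k);
     exact: chart_img_open.
Qed.
HB.instance Definition _ :=
  GRing.isSubringClosed.Build (M -> R) smooth_pred smooth_subring_closed.

Fact smooth_scaler_closed : GRing.scaler_closed smooth_pred.
Proof.
move=> a f /asboolP sf; apply/asboolP => c ac k.
exact: Ck_onM (chart_img_open c) (Ck_on_cst k _ a) (sf c ac k).
Qed.
HB.instance Definition _ :=
  GRing.isScaleClosed.Build R (M -> R) smooth_pred smooth_scaler_closed.

Record Cinf := MkCinf {
  Cinf_fun :> M -> R;
  Cinf_smooth : Cinf_fun \in smooth_pred }.

HB.instance Definition _ := [isSub for Cinf_fun].
HB.instance Definition _ := [Choice of Cinf by <:].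
HB.instance Definition _ := GRing.SubChoice_isSubComPzRing.Build
  (M -> R) smooth_pred Cinf smooth_subring_closed.
HB.instance Definition _ := [SubZmodule_isSubLmodule of Cinf by <:].

Lemma CinfP (f g : Cinf) : f =1 g -> f = g.
Proof. by move=> fg; apply/val_inj/funext. Qed.

Lemma CinfD (f g : Cinf) p : (f + g) p = f p + g p. Proof. by []. Qed.
Lemma CinfN (f : Cinf) p : (- f) p = - f p. Proof. by []. Qed.
Lemma CinfM (f g : Cinf) p : (f * g) p = f p * g p. Proof. by []. Qed.
Lemma CinfZ (a : R) (f : Cinf) p : (a *: f) p = a * f p. Proof. by []. Qed.
Lemma Cinf0 p : (0 : Cinf) p = 0. Proof. by []. Qed.
Lemma Cinf1 p : (1 : Cinf) p = 1. Proof. by []. Qed.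
Definition CinfE := (CinfD, CinfN, CinfM, CinfZ, Cinf0, Cinf1).

Definition Cinf_const (a : R) : Cinf := a *: (1 : Cinf).

End SmoothFunctions.

Section VectorFields.
Context {R : realType} {m : nat} (M : smooth_manifold R m).
Local Notation C := (Cinf M).

(* Vector fields are the derivations of the R-algebra C^oo(M). The codomain is
   written C^o so that they form a C^oo(M)-module: (f *: X) h = f * X h. *)
Definition derivation (X : C -> C^o) :=
  (forall (a : R) (f h : C), X (a *: f + h) = a *: (X f : C) + X h) /\
  (forall f h : C, X (f * h) = X f * h + f * X h).

Definition derivation_pred : {pred C -> C^o} := fun X => `[< derivation X >].

Fact derivation_submod_closed : submod_closed derivation_pred.
Proof.
split=> [|u X Y /asboolP[XD XM] /asboolP[YD YM]]; apply/asboolP; split.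
- move=> a f h; apply: CinfP => p.
  have -> k : (0 : C -> C^o) k = 0 by [].
  by rewrite !CinfE mulr0 addr0.
- by move=> f h; rewrite -[LHS]/(0 : C) mul0r mulr0 addr0.
- move=> a f h; apply: CinfP => p.
  have -> : (u *: X + Y) (a *: f + h) =
    u * X (a *: f + h) + Y (a *: f + h) by [].
  have -> k : (u *: X + Y) k = u * X k + Y k by [].
  rewrite XD YD !CinfE.
  by rewrite !mulrDr mulrCA addrACA.
- move=> f h.
  have E k : (u *: X + Y) k = u * X k + Y k by [].
  by rewrite !E XM YM !mulrDr !mulrDl addrACA !mulrA [u * f]mulrC.
Qed.

Record vfield := MkVfield {
  vfield_fun :> C -> C^o;
  vfieldP : vfield_fun \in derivation_pred }.

HB.instance Definition _ := [isSub for vfield_fun].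
HB.instance Definition _ := [Choice of vfield by <:].
HB.instance Definition _ := GRing.SubChoice_isSubLmodule.Build
  C (C -> C^o) derivation_pred vfield derivation_submod_closed.

Definition commutator (X Y : vfield) : C -> C^o := fun f => X (Y f) - Y (X f).

Fact commutator_derivation (X Y : vfield) : commutator X Y \in derivation_pred.
Proof.
have /asboolP[XD XM] := vfieldP X; have /asboolP[YD YM] := vfieldP Y.
have XA f h : X (f + h) = X f + X h by rewrite -[f in LHS]scale1r XD scale1r.
have YA f h : Y (f + h) = Y f + Y h by rewrite -[f in LHS]scale1r YD scale1r.
apply/asboolP; split=> [a f h|f h]; rewrite /commutator.
  rewrite YD XD XD YD; apply: CinfP => p; rewrite !CinfE.
  by rewrite mulrDr mulrN opprD addrACA.
rewrite YM XM XA YA !XM !YM mulrBl mulrBr.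
apply: CinfP => p; rewrite !CinfE; ring.
Qed.

Definition lie_bracket (X Y : vfield) : vfield :=
  MkVfield (commutator_derivation X Y).

End VectorFields.

(* Tensor fields are the C^oo(M)-multilinear maps on vector fields: an
   endomorphism field is {linear vfield M -> vfield M} and a 1-form is
   {linear vfield M -> (Cinf M)^o}. *)
Section RiemannianGeometry.
Context {R : realType} {m : nat} {M : smooth_manifold R m}.
Local Notation C := (Cinf M).
Local Notation V := (vfield M).
Implicit Types (X Y Z : V) (f : C).

(* The tangent vector of X at p vanishes iff it kills all smooth functions. *)
Record riemannian_metric := RiemannianMetric {
  metric :> V -> V -> C;
  metric_linear : forall f X Y Z,
    metric (f *: X + Y) Z = f * metric X Z + metric Y Z;
  metric_sym : forall X Y, metric X Y = metric Y X;
  metric_ge0 : forall X (p : M), 0 <= metric X X p;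
  metric_definite : forall X (p : M),
    metric X X p = 0 -> forall f, (X f : C) p = 0 }.

Record affine_connection := AffineConnection {
  nabla :> V -> V -> V;
  nabla_linear : forall f X Y Z,
    nabla (f *: X + Y) Z = f *: nabla X Z + nabla Y Z;
  nabla_additive : forall X Y Z, nabla X (Y + Z) = nabla X Y + nabla X Z;
  nabla_leibniz : forall X f Y,
    nabla X (f *: Y) = (X f : C) *: Y + f *: nabla X Y }.

Definition metric_connection (g : riemannian_metric) (D : affine_connection) :=
  forall X Y Z, X (g Y Z) = g (D X Y) Z + g Y (D X Z).

Definition torsion (D : affine_connection) X Y : V :=
  D X Y - D Y X - lie_bracket X Y.

(* t restricts to a 3-form on the C^oo(M)-submodule E of vector fields. *)
Definition three_form_on (E : set V) (t : V -> V -> V -> C) :=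
  [/\ forall f X Y Z W, E X -> E Y -> E Z -> E W ->
        t (f *: X + Y) Z W = f * t X Z W + t Y Z W,
      forall f X Y Z W, E X -> E Y -> E Z -> E W ->
        t Z (f *: X + Y) W = f * t Z X W + t Z Y W,
      forall f X Y Z W, E X -> E Y -> E Z -> E W ->
        t Z W (f *: X + Y) = f * t Z W X + t Z W Y &
      forall X Y, E X -> E Y ->
        [/\ t X X Y = 0, t X Y X = 0 & t Y X X = 0]].

Definition skew_torsion (g : riemannian_metric) (D : affine_connection) :=
  three_form_on setT (fun X Y Z => g (torsion D X Y) Z).

Definition ext_diff (eta : V -> C^o) X Y : C :=
  (X (eta Y) : C) - Y (eta X) - eta (lie_bracket X Y).

Definition lie_endo (X : V) (phi : V -> V) Y : V :=
  lie_bracket X (phi Y) - phi (lie_bracket X Y).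

Definition nabla_endo (D : affine_connection) X (phi : V -> V) Y : V :=
  D X (phi Y) - phi (D X Y).

Definition lie_metric (X : V) (g : riemannian_metric) Y Z : C :=
  (X (g Y Z) : C) - g (lie_bracket X Y) Z - g Y (lie_bracket X Z).

Definition killing (g : riemannian_metric) X :=
  forall Y Z, lie_metric X g Y Z = 0.

End RiemannianGeometry.
Arguments riemannian_metric {R m} M.
Arguments affine_connection {R m} M.

Section AlmostContact.
Context {R : realType} {m : nat} {M : smooth_manifold R m}.
Local Notation C := (Cinf M).
Local Notation V := (vfield M).
Implicit Types (X Y Z : V) (f : C).

Record almost_contact_metric (g : riemannian_metric M) := AlmostContactMetric {
  phi : {linear V -> V};
  xi : V;
  eta : {linear V -> C^o};
  phi_sq : forall X, phi (phi X) = - X + eta X *: xi;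
  eta_xi : eta xi = 1;
  metric_phi : forall X Y, g (phi X) (phi Y) = g X Y - eta X * eta Y }.

Definition nijenhuis g (s : almost_contact_metric g) X Y : V :=
  lie_bracket (phi s X) (phi s Y) + phi s (phi s (lie_bracket X Y))
  - phi s (lie_bracket (phi s X) Y) - phi s (lie_bracket X (phi s Y))
  + ext_diff (eta s) X Y *: xi s.

(* The indices 1, 2, 3 are the elements 0, 1, 2 of 'I_3. *)
Definition even_triple (i j k : 'I_3) :=
  exists2 s : 'S_3, ~~ odd_perm s & [/\ i = s 0, j = s 1 & k = s 2].

Definition levi_civita (i j k : 'I_3) : int :=
  \sum_(s : 'S_3 | [&& s 0 == i, s 1 == j & s 2 == k]) (-1) ^+ odd_perm s.

Section ThreeContact.
Context {g : riemannian_metric M}.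
Variable S : 'I_3 -> almost_contact_metric g.

Definition almost_3_contact := forall i j k : 'I_3, even_triple i j k ->
  [/\ (forall X, phi (S k) X = phi (S i) (phi (S j) X) - eta (S j) X *: xi (S i)) /\
      (forall X, phi (S k) X = - phi (S j) (phi (S i) X) + eta (S i) X *: xi (S j)),
      xi (S k) = phi (S i) (xi (S j)) /\ xi (S k) = - phi (S j) (xi (S i)) &
      (forall X, eta (S k) X = eta (S i) (phi (S j) X)) /\
      (forall X, eta (S k) X = - eta (S j) (phi (S i) X))].

Definition horizontal : set V := [set X | forall i, eta (S i) X = 0].

Definition vertical : set V :=
  [set X | exists f : 'I_3 -> C, X = \sum_i f i *: xi (S i)].

(* Real coefficients act on vector fields as constant functions. *)
Definition associated_sphere (s : almost_contact_metric g) :=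
  exists a : 'I_3 -> R,
    [/\ \sum_i a i ^+ 2 = 1,
        forall X, phi s X = \sum_i Cinf_const M (a i) *: phi (S i) X,
        xi s = \sum_i Cinf_const M (a i) *: xi (S i) &
        forall X, eta s X = \sum_i Cinf_const M (a i) * eta (S i) X].

Definition skew_nijenhuis_on_horizontal (s : almost_contact_metric g) :=
  three_form_on horizontal (fun X Y Z => g (nijenhuis s X Y) Z).

Definition reeb_commutator (delta : C) := forall i j k : 'I_3,
  eta (S k) (lie_bracket (xi (S i)) (xi (S j))) =
  (delta *+ 2) *~ levi_civita i j k.

Definition preserves_splitting (D : affine_connection M) :=
  (forall X Y, horizontal Y -> horizontal (D X Y)) /\
  (forall X Y, vertical Y -> vertical (D X Y)).

Definition compatible_connection (s : almost_contact_metric g)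
    (D : affine_connection M) :=
  [/\ metric_connection g D, skew_torsion g D, preserves_splitting D &
      forall X Y, horizontal X -> horizontal Y -> nabla_endo D X (phi s) Y = 0].

Definition parameter_function (D : affine_connection M) : C :=
  g (torsion D (xi (S 0)) (xi (S 1))) (xi (S 2)).

End ThreeContact.
End AlmostContact.

(* Main.v *)
(* Vector fields are global derivations of C^oo(M), so the Koszul formula defines
   a connection as soon as every C^oo(M)-linear form on them is g(Z, .) for some
   vector field Z. Around a point, Hadamard's lemma writes every derivation in
   terms of coordinate fields cut off by a bump function; inverting the Gram
   matrix represents a multiple d of the form, with d nonzero at the point, and
   the resulting quotients agree pointwise.

   A compatible connection is determined by its torsion T. Preserving the
   splitting forces T(X, Y, xi_i) = d eta_i(X, Y) for Y horizontal, and on H the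
   condition (nabla_X phi) Y = 0 is solved, as in Hermitian geometry with
   torsion, by T = N_phi - d Phi(phi, phi, phi), where Phi(X, Y) = g(X, phi Y);
   this is where the skew-symmetry of N_phi is used. Both formulas of the
   statement are read off from T and the Koszul formula, in which the Killing
   condition cancels all terms except d eta_i. *)
From mathcomp Require Import ereal sequences realfun exp.
From mathcomp Require Import measure lebesgue_measure lebesgue_integral ftc.
From mathcomp Require Import ring lra.
Require Import Defs.
Set Implicit Arguments.
Unset Strict Implicit.
Unset Printing Implicit Defensive.
Local Open Scope classical_set_scope.
Local Open Scope ring_scope.

(** * Partial derivatives and C^k functions *)

Section Calculus.
Context {R : realType}.

(** [smooth_on] speaks only of continuity and iterated partial derivatives, so the calculus is
    rebuilt on that notion: the chain rule, which lets a function be transported between charts, and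
    the smoothness of the integral coefficients in Hadamard's lemma, without which a derivation
    could not be applied to them. Division is postponed in the local part: C^oo(M) has few units, so
    coordinates, frames and local solutions carry powers of a bump function or a determinant as
    denominators. On the geometric side the obstacle is consistency. T(X, Y, xi_i) = d eta_i(X, Y)
    is imposed on one 3-form for three indices at once, so d eta_i(xi_j, Y) must be skew in i and j
    for horizontal Y. The Killing condition supplies this through d eta_i(xi_j, Y) = g([xi_j, xi_i],
    Y). Compatibility leaves the value of T on the three Reeb fields free, and so it enters the
    formulas as the parameter gamma. The torsion built for existence has gamma = -3 delta whenever
    delta exists. *)

Lemma is_derive_line (W : normedModType R) (f : W -> R) (x v : W) (s : R) :
  derivable f (x + s *: v) v ->
  is_derive s 1 (fun t => f (x + t *: v)) ('D_v f (x + s *: v)).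
Proof.
have E : (fun h : R => h^-1 *: (f (x + (h *: 1 + s) *: v) - f (x + s *: v)))
   = (fun h : R => h^-1 *: (f (h *: v + (x + s *: v)) - f (x + s *: v))).
  apply/funext => h; congr (_ *: (f _ - _)).
  by rewrite [h *: 1]mulr1 scalerDl addrCA.
move=> d; split; first by rewrite /derivable /= E.
by rewrite /derive /= E.
Qed.

(** The mean value theorem is applied to t -> f(t w) on [0, 1], not to f between 0 and w, so that w
    may be negative or zero. *)
Lemma mean_value_close (f : R -> R) (w l e : R) :
  0 <= e ->
  (forall t, 0 <= t <= 1 -> derivable f (t * w) 1 /\ `|'D_1 f (t * w) - l| <= e) ->
  exists2 a, `|a - l| <= e & f w - f 0 = w * a.
Proof.
move=> e0 fP.
have dg (t : R) : 0 <= t <= 1 ->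
    is_derive t 1 (fun t => f (t * w)) (w * 'D_1 f (t * w)).
  move=> /fP[d _].
  have H : is_derive (t * w) 1 f ('D_1 f (t * w)) by exact: DeriveDef.
  have K : is_derive t 1 ( *%R^~ w) w.
    have := @is_deriveM R _ id (cst w) t 1 1 0 (is_derive_id _ _) (is_derive_cst _ _ _).
    by move=> K; apply: (is_derive_eq K); rewrite scaler0 add0r [cst w t *: _]mulr1.
  have := @is_derive1_comp R f ( *%R^~ w) t ('D_1 f (t * w)) w H K.
  by move=> L; apply: (is_derive_eq L); rewrite mulrC.
have [||c] := @MVT_segment R (fun t => f (t * w)) (fun t => w * 'D_1 f (t * w)) 0 1 ler01.
- move=> t; rewrite in_itv/= => /andP[t0 t1]; apply: dg; rewrite !ltW//.
- apply: derivable_within_continuous => t; rewrite in_itv/= => tI.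
  by have [] := dg t tI.
rewrite in_itv/= => /fP[_ cl]; rewrite mul1r mul0r subr0 mulr1 => ->.
by exists ('D_1 f (c * w)).
Qed.

Lemma dist_convex (u v c r t : R) : 0 <= t <= 1 -> `|c - u| < r -> `|c - v| < r ->
  `|c - (u + t * (v - u))| < r.
Proof.
move=> /andP[t0 t1] cu cv.
have -> : c - (u + t * (v - u)) = (1 - t) * (c - u) + t * (c - v) by ring.
apply: (@le_lt_trans _ _ (Num.max `|c - u| `|c - v|)); last by rewrite gt_max cu.
rewrite (le_trans (ler_normD _ _)) // !normrM (ger0_norm t0) ger0_norm ?subr_ge0 //.
rewrite -[leRHS]mul1r -[X in X * Num.max _ _](subrK t) [leRHS]mulrDl.
by rewrite lerD // ler_wpM2l ?subr_ge0 // le_max lexx ?orbT.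
Qed.

(* The box is convex coordinatewise, so the points obtained from x by replacing
   its coordinates one at a time with those of x' stay in it. *)
Lemma box_increment m (f : 'rV[R]_m -> R) (x0 x x' : 'rV[R]_m) (r e : R)
    (l : 'I_m -> R) :
  0 <= e ->
  (forall z, ball x0 r z -> forall j, derivable f z (delta_mx 0 j) /\
     `|'D_(delta_mx 0 j) f z - l j| <= e) ->
  ball x0 r x -> ball x0 r x' ->
  exists2 a : 'I_m -> R, (forall j, `|a j - l j| <= e) &
    f x' - f x = \sum_j (x' 0 j - x 0 j) * a j.
Proof.
move=> e0 fP bx bx'.
pose y (k : nat) : 'rV[R]_m := \row_j (if (j < k)%N then x' 0 j else x 0 j).
have y0 : y 0%N = x by apply/rowP => j; rewrite mxE.
have ym : y m = x' by apply/rowP => j; rewrite mxE ltn_ord.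
have /choice[a aP] : forall j : 'I_m, exists a, `|a - l j| <= e /\
    f (y j.+1) - f (y j) = (x' 0 j - x 0 j) * a.
  move=> j; set w := x' 0 j - x 0 j.
  have yS : y j.+1 = y j + w *: delta_mx 0 j.
    apply/rowP => i; rewrite !mxE eqxx /= ltnS leq_eqVlt.
    have [->|ne] := eqVneq i j; first by rewrite eqxx ltnn /= mulr1 addrC subrK.
    by rewrite (negbTE ne : (i == j :> nat) = false) mulr0 addr0.
  have [t t01|a al E] :=
      @mean_value_close (fun s => f (y j + s *: delta_mx 0 j)) w (l j) e e0.
    have bz : ball x0 r (y j + (t * w) *: delta_mx 0 j).
      have [r0 bxi] := bx; have [_ bxi'] := bx'.
      split=> // i k; rewrite (ord1 i) /ball /= !mxE eqxx /=.
      have [->|ne] := eqVneq k j.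
        by rewrite ltnn mulr1; apply: dist_convex => //; [exact: bxi|exact: bxi'].
      by rewrite mulr0 addr0; case: ifP => _; [exact: bxi'|exact: bxi].
    have [d dl] := fP _ bz j.
    have D := @is_derive_line _ f (y j) (delta_mx 0 j) (t * w) d.
    split; first exact: ex_derive.
    by rewrite derive_val.
  exists a; split => //; rewrite yS.
  by move: E => /=; rewrite scale0r addr0.
exists a => [j|]; first by have [] := aP j.
have -> : f x' - f x = f (y m) - f (y 0%N) by rewrite ym y0.
rewrite -(@telescope_sumr _ 0 m (f \o y)) // big_mkord.
by apply: eq_bigr => j _; have [_ <-] := aP j.
Qed.

Lemma cvg_rowP (T : Type) (F : set_system T) {FF : Filter F} m (u : T -> 'rV[R]_m)
    (l : 'rV[R]_m) : (forall j, u t 0 j @[t --> F] --> l 0 j) -> u @ F --> l.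
Proof.
move=> H; apply/cvg_ballP => e e0.
have : \forall t \near F, forall j, ball (l 0 j) e (u t 0 j).
  by apply: filter_forall => j; have /cvg_ballP := H j; apply.
by apply: filterS => t K; split=> // i j; rewrite (ord1 i); exact: K.
Qed.

Lemma continuous_row (T : topologicalType) m (u : T -> 'rV[R]_m) (y : T) :
  (forall j, {for y, continuous (fun z => u z 0 j)}) -> {for y, continuous u}.
Proof. by move=> H; apply: (@cvg_rowP _ (nbhs y) (nbhs_filter y)) => j; exact: H. Qed.

(** By [box_increment] the difference quotient of [f \o tau] is sum_j q_j a_j, with q_j the quotient
    of the j-th coordinate of tau and a_j close to the j-th partial derivative at [tau y].
    Continuity of the partial derivatives thus does the work of total differentiability. *)
Lemma derive_comp_row (W : normedModType R) m (f : 'rV[R]_m -> R)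
    (tau : W -> 'rV[R]_m) (y v : W) :
  (\forall z \near tau y, forall j, derivable f z (delta_mx 0 j)) ->
  (forall j, {for tau y, continuous ('D_(delta_mx 0 j) f)}) ->
  (forall j, derivable (fun z => tau z 0 j) y v) ->
  is_derive y v (f \o tau)
    (\sum_j 'D_v (fun z => tau z 0 j) y * 'D_(delta_mx 0 j) f (tau y)).
Proof.
move=> fd fc td.
pose q j h := h^-1 *: (tau (h *: v + y) 0 j - tau y 0 j).
pose l j := 'D_(delta_mx 0 j) f (tau y).
pose dt j := 'D_v (fun z => tau z 0 j) y.
have qc j : q j h @[h --> 0^'] --> dt j by exact: td.
suff H : h^-1 *: ((f \o tau) (h *: v + y) - (f \o tau) y) @[h --> 0^'] -->
    \sum_j dt j * l j.
  split; first by apply/cvg_ex; exists (\sum_j dt j * l j).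
  exact/cvg_lim.
(* Continuity of tau along the line comes from derivability of its coordinates: the increment is h
   q_j(h), which tends to 0. *)
have tc : tau (h *: v + y) @[h --> (0:R)^'] --> tau y.
  apply: cvg_rowP => j.
  have E : \forall h \near (0:R)^', tau y 0 j + h * q j h = tau (h *: v + y) 0 j.
    near=> h; rewrite [h * _]mulrA mulfV ?mul1r; first by rewrite [LHS]addrC subrK.
    by near: h; exact: nbhs_dnbhs_neq.
  suff K : tau y 0 j + h * q j h @[h --> (0:R)^'] --> tau y 0 j + 0 * dt j.
    rewrite mul0r addr0 in K.
    by apply: cvg_trans K; exact: near_eq_cvg.
  apply: cvgD; first exact: cvg_cst.
  apply: cvgM; last exact: qc.
  exact: cvg_within.
apply/cvgrPdist_le => e e0.
(* Near h = 0 each |q_j| is at most |dt_j| + 1, so replacing a_j by l_j costs at most M e1 <= e / 2.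
   The summand 1 in 1 + M keeps [e1] positive when m = 0. *)
pose M := \sum_j (`|dt j| + 1).
have M0 : 0 <= M by apply: sumr_ge0 => j _; rewrite addr_ge0.
pose e1 := e / 2 / (1 + M).
have e10 : 0 < e1 by rewrite !divr_gt0 // ltr_wpDr.
have [r /= r0 rP] : exists2 r, 0 < r & forall z, ball (tau y) r z -> forall j,
    derivable f z (delta_mx 0 j) /\ `|'D_(delta_mx 0 j) f z - l j| <= e1.
  have : \forall z \near tau y, forall j, derivable f z (delta_mx 0 j) /\
     `|'D_(delta_mx 0 j) f z - l j| <= e1.
    apply: (@filter_forall _ _ (fun j z => derivable f z (delta_mx 0 j) /\
      `|'D_(delta_mx 0 j) f z - l j| <= e1) _ (nbhs_filter (tau y))) => j.
    near=> z; split.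
      by near: z; apply: filterS fd => z; exact.
    by rewrite distrC; near: z; have /cvgrPdist_le := fc j; apply.
  by move/nbhs_ballP => [r r0 rP]; exists r.
have sc : \sum_j q j h * l j @[h --> 0^'] --> \sum_j dt j * l j.
  apply: (cvg_big (op := +%R)) => [|j _]; first exact: add_continuous.
  apply: cvgM; [exact: qc|exact: cvg_cst].
near=> h.
have [a al E] : exists2 a : 'I_m -> R, (forall j, `|a j - l j| <= e1) &
    f (tau (h *: v + y)) - f (tau y) =
    \sum_j (tau (h *: v + y) 0 j - tau y 0 j) * a j.
  apply: (box_increment (x0 := tau y) (r := r)) => //.
  - exact: ltW.
  - exact: ballxx.
  - by near: h; have /cvg_ballP := tc; apply.
rewrite /= E scaler_sumr.
rewrite [X in `|_ - X|](_ : _ = \sum_j q j h * l j + \sum_j q j h * (a j - l j)).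
  rewrite opprD addrA (le_trans (ler_normB _ _)) // (splitr e) lerD //.
    by near: h; have /cvgrPdist_le := sc; apply; rewrite divr_gt0.
  rewrite (@le_trans _ _ (\sum_j (`|dt j| + 1) * e1)) //.
    rewrite (le_trans (ler_norm_sum _ _ _)) //; apply: ler_sum => j _.
    rewrite normrM ler_pM // -lerBlDl.
    have : `|dt j - q j h| <= 1.
      move: j; near: h; apply: filter_forall => j.
      by have /cvgrPdist_le := qc j; apply.
    apply: le_trans; rewrite distrC; exact: lerB_dist.
  rewrite -mulr_suml -/M /e1 mulrCA ler_piMr ?divr_ge0 // ?ltW//.
  by rewrite ltr_pdivrMr ?mul1r ?ltrDr ?ltr_wpDr // ltrDl.
rewrite -big_split /=; apply: eq_bigr => j _; rewrite -mulrDr [l j + _]addrC subrK /q.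
by rewrite scalerAl.
Unshelve. all: by end_near. Qed.

Section CkOn.
Context {m : nat}.
Implicit Types (U : set 'rV[R]_m) (f g : 'rV[R]_m -> R).

Lemma Ck_on_continuous k U f x : Ck_on k U f -> U x -> {for x, continuous f}.
Proof. by case: k => [|k] [H _]; exact: H. Qed.

Lemma Ck_on_sub k U U' f : U' `<=` U -> Ck_on k U f -> Ck_on k U' f.
Proof.
move=> sU; elim: k f => [|k IH] f [cf df]; split=> //;
  try by move=> x /sU; exact: cf.
by move=> i; have [d1 d2] := df i; split=> [x /sU|]; [exact: d1|exact: IH].
Qed.

(** [Ck_on] is a pointwise condition: continuity and partial derivatives are taken in the ambient
    space at each point of the set. It can therefore be tested on any sets that cover U. *)
Lemma Ck_on_local k U f :
  (forall x, U x -> exists O : set 'rV[R]_m, O x /\ Ck_on k O f) -> Ck_on k U f.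
Proof.
elim: k f => [|k IH] f H; split=> //;
  try by move=> x /H[O [Ox]] /Ck_on_continuous; exact.
move=> i; split=> [x /H[O [Ox [_ d]]]|]; first by have [d1 _] := d i; exact: d1.
by apply: IH => x /H[O [Ox [_ d]]]; exists O; split=> //; have [] := d i.
Qed.

Lemma Ck_on_deriv k U f i :
  Ck_on k.+1 U f -> Ck_on k U (fun x => 'D_(delta_mx 0 i) f x).
Proof. by case=> _ H; have [] := H i. Qed.

Lemma Ck_on_derivable k U f i x :
  Ck_on k.+1 U f -> U x -> derivable f x (delta_mx 0 i).
Proof. by case=> _ H; have [d _] := H i; exact: d. Qed.

Lemma Ck_onN k U f : open U -> Ck_on k U f -> Ck_on k U (- f).
Proof.
move=> oU cf; have := Ck_onM oU (Ck_on_cst k U (-1)) cf.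
by apply: Ck_on_eq => // x _; rewrite !fctE mulN1r.
Qed.

Lemma Ck_onB k U f g : open U -> Ck_on k U f -> Ck_on k U g -> Ck_on k U (f - g).
Proof. by move=> oU cf cg; apply: Ck_onD => //; exact: Ck_onN. Qed.

Lemma Ck_on_sum k U (I : Type) (s : seq I) (f : I -> 'rV[R]_m -> R) :
  open U -> (forall i, Ck_on k U (f i)) ->
  Ck_on k U (fun x => \sum_(i <- s) f i x).
Proof.
move=> oU cf; elim: s => [|i s IH].
  by apply: Ck_on_eq (Ck_on_cst k U 0) => // x _; rewrite big_nil.
by apply: Ck_on_eq (Ck_onD oU (cf i) IH) => // x _; rewrite big_cons.
Qed.

Lemma Ck_on_prod k U (I : Type) (s : seq I) (f : I -> 'rV[R]_m -> R) :
  open U -> (forall i, Ck_on k U (f i)) ->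
  Ck_on k U (fun x => \prod_(i <- s) f i x).
Proof.
move=> oU cf; elim: s => [|i s IH].
  by apply: Ck_on_eq (Ck_on_cst k U 1) => // x _; rewrite big_nil.
by apply: Ck_on_eq (Ck_onM oU (cf i) IH) => // x _; rewrite big_cons.
Qed.

Lemma is_derive_coord (i j : 'I_m) (x : 'rV[R]_m) :
  is_derive x (delta_mx 0 j) (fun y : 'rV[R]_m => y 0 i) (i == j)%:R.
Proof.
have d : differentiable (fun y : 'rV[R]_m => y 0 i) x by exact: differentiable_coord.
split; first exact: diff_derivable.
apply/cvg_lim => //=.
suff H : \forall h \near (0 : R)^', (i == j)%:R =
    h^-1 *: ((h *: delta_mx 0 j + x) 0 i - x 0 i).
  by apply: cvg_trans (near_eq_cvg H) _; exact: cvg_cst.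
near=> h.
have h0 : h != 0 by near: h; exact: nbhs_dnbhs_neq.
by rewrite !mxE eqxx /= addrK [RHS]mulKf.
Unshelve. all: by end_near. Qed.

Lemma Ck_on_coord k U (i : 'I_m) : open U -> Ck_on k U (fun x => x 0 i).
Proof.
move=> oU; case: k => [|k]; split=> //;
  try by move=> x _; apply: differentiable_continuous; exact: differentiable_coord.
move=> j; split=> [x _|]; first by have [] := is_derive_coord i j x.
apply: Ck_on_eq (Ck_on_cst k U (i == j)%:R) => // x _.
by rewrite (derive_val (is_derive := is_derive_coord i j x)).
Qed.

Lemma Ck_onV k U f : open U -> (forall x, U x -> f x != 0) ->
  Ck_on k U f -> Ck_on k U (fun x => (f x)^-1).
Proof.
move=> oU f0; elim: k => [|k IH] cf; split=> //;
  try by move=> x Ux; exact: (cvgV (f0 _ Ux) (Ck_on_continuous cf Ux)).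
move=> i; split=> [x Ux|].
  by apply: derivableV; [exact: f0|exact: Ck_on_derivable cf Ux].
have cv := IH (Ck_onW cf).
apply: Ck_on_eq (Ck_onN oU (Ck_onM oU (Ck_onM oU cv cv) (Ck_on_deriv i cf))) => //.
move=> x Ux; have /= := deriveV (f0 _ Ux) (Ck_on_derivable (i := i) cf Ux).
by move=> ->; rewrite !fctE /= scaleNr -exprVn expr2.
Qed.

End CkOn.

(** The chain rule expresses a partial derivative of the composite through the functions (d_i f) o
    tau, whose order is one lower; hence the induction on k with f generalized. *)
Lemma Ck_on_comp n m k (U : set 'rV[R]_n) (U' : set 'rV[R]_m) f
    (tau : 'rV[R]_m -> 'rV[R]_n) :
  open U -> open U' -> (forall y, U' y -> U (tau y)) ->
  (forall i, Ck_on k U' (fun y => tau y 0 i)) ->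
  Ck_on k U f -> Ck_on k U' (f \o tau).
Proof.
move=> oU oU' tU; elim: k f => [|k IH] f ct cf;
  have cft y : U' y -> {for y, continuous (f \o tau)} by
    move=> Uy; apply: continuous_comp;
    [ apply: continuous_row => i; exact: (Ck_on_continuous (ct i) Uy)
    | exact: (Ck_on_continuous cf (tU _ Uy))].
  by split.
split=> //.
move=> j; have D y : U' y -> is_derive y (delta_mx 0 j) (f \o tau)
    (\sum_i 'D_(delta_mx 0 j) (fun z => tau z 0 i) y *
      'D_(delta_mx 0 i) f (tau y)).
  move=> Uy; apply: derive_comp_row => [|i|i].
  - near=> z => i; apply: (Ck_on_derivable cf).
    by near: z; apply: open_nbhs_nbhs; split=> //; exact: tU.
  - exact: (Ck_on_continuous (Ck_on_deriv i cf) (tU _ Uy)).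
  - exact: (Ck_on_derivable (ct i)).
split=> [y /D|]; first by case.
apply: (Ck_on_eq (f := fun y => \sum_i 'D_(delta_mx 0 j) (fun z => tau z 0 i) y *
      'D_(delta_mx 0 i) f (tau y))) => // [y /D H|].
  by rewrite derive_val.
apply: Ck_on_sum => // i; apply: (Ck_onM oU'); first exact: Ck_on_deriv (ct i).
by apply: (IH ('D_(delta_mx 0 i) f)) => [i'|]; [exact: Ck_onW|exact: Ck_on_deriv].
Unshelve. all: by end_near. Qed.

End Calculus.

(** * A flat function *)

Section FlatFunction.
Context {R : realType}.

Lemma is_derive_lineE (W : normedModType R) (f : W -> R) (x v : W) (d : R) :
  is_derive x v f d <-> is_derive (0 : R) 1 (fun t => f (t *: v + x)) d.
Proof.
have E : (fun h : R => h^-1 *: (f ((h *: 1 + 0 : R) *: v + x) - f ((0 : R) *: v + x)))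
   = (fun h : R => h^-1 *: (f (h *: v + x) - f x)).
  by apply/funext => h; rewrite addr0 [h *: 1]mulr1 scale0r add0r.
split=> -[].
  by move=> D1 D2; split; [rewrite /derivable /= E|rewrite /derive /= E].
by rewrite /derivable /derive /= E => D1 D2; split.
Qed.

Lemma is_derive_comp1 (W : normedModType R) (f : R -> R) (q : W -> R) (x v : W)
    (df dq : R) :
  is_derive (q x) 1 f df -> is_derive x v q dq ->
  is_derive x v (f \o q) (df * dq).
Proof.
move=> Df /is_derive_lineE Dq; apply/is_derive_lineE.
have Df' : is_derive (q (0 *: v + x)) 1 f df by rewrite scale0r add0r.
exact: (@is_derive1_comp R f (fun t => q (t *: v + x)) 0 df dq Df' Dq).
Qed.

(* The factor t^-n makes the family closed under differentiation. *)
Definition flat_exp (n : nat) (t : R) : R :=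
  if 0 < t then t^-1 ^+ n * expR (- t^-1) else 0.

Lemma flat_exp_gt0 n t : 0 < t -> 0 < flat_exp n t.
Proof. by move=> t0; rewrite /flat_exp t0 mulr_gt0 ?exprn_gt0 ?invr_gt0 ?expR_gt0. Qed.

Lemma flat_exp_le0 n t : t <= 0 -> flat_exp n t = 0.
Proof. by rewrite /flat_exp leNgt => /negbTE ->. Qed.

(** The constant comes from exp u >= u^(n+2) / (n+2)! at u = 1/t. The exponent 2 on the right makes
    the difference quotient at 0 tend to 0. *)
Lemma flat_exp_bound n t : `|flat_exp n t| <= (n.+2)`!%:R * t ^+ 2.
Proof.
have [t0|t0] := ltP 0 t; last first.
  by rewrite flat_exp_le0 // normr0 mulr_ge0 ?sqr_ge0.
rewrite gtr0_norm ?flat_exp_gt0 // /flat_exp t0 expRN.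
have u0 : 0 < t^-1 by rewrite invr_gt0.
have F0 : 0 < (n.+2)`!%:R :> R by rewrite ltr0n fact_gt0.
have := @expR_ge1Dxn R t^-1 n.+1 (ltW u0) => H.
have {}H : t^-1 ^+ n.+2 / (n.+2)`!%:R <= expR t^-1.
  by apply: le_trans H; rewrite lerDr.
rewrite ler_pdivrMr ?expR_gt0 // (le_trans _ (ler_wpM2l _ H)) //; last first.
  by rewrite mulr_ge0 ?sqr_ge0 ?ltW.
rewrite mulrACA [X in _ <= X]mulrC.
rewrite le_eqVlt; apply/orP; left; apply/eqP.
rewrite (exprS _ n.+1) (exprS _ n); set u := t^-1 ^+ n; field.
by rewrite !gt_eqF.
Qed.

Lemma is_derive_flat_exp n (t : R) :
  is_derive t 1 (flat_exp n) (flat_exp n.+2 t - n%:R * flat_exp n.+1 t).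
Proof.
have [t0|t0|->] := ltgtP t 0.
- rewrite !flat_exp_le0 ?ltW // mulr0 subr0.
  apply: (near_eq_is_derive (f := cst 0)) => //.
  by near=> u; rewrite flat_exp_le0 // ltW //; near: u; exact: lt_nbhsl.
- rewrite /flat_exp t0.
  have t0' : t != 0 by rewrite gt_eqF.
  have Di : is_derive t 1 (fun u : R => u^-1) (- (t^-1 ^+ 2)).
    apply: (is_derive_eq (is_deriveV t0' (is_derive_id t 1))).
    by rewrite -exprVn [_ *: _]mulr1.
  have De : is_derive t 1 (fun u : R => expR (- u^-1)) (t^-1 ^+ 2 * expR (- t^-1)).
    have := is_derive_comp1 (q := - (fun u : R => u^-1))
      (is_derive_expR (- t^-1)) (is_deriveN Di).
    by rewrite opprK mulrC.
  have := is_deriveM (is_deriveX n Di) De => D.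
  apply: (near_eq_is_derive (f := (fun u : R => u^-1) ^+ n * (fun u => expR (- u^-1)))).
  + near=> u; have -> : 0 < u by near: u; exact: lt_nbhsr.
    by rewrite !fctE.
  + apply: (is_derive_eq D); rewrite !fctE /=.
    rewrite /GRing.scale /=.
    by case: (n) => [|k] /=; rewrite ?mul0r !exprS; ring.
rewrite !flat_exp_le0 // mulr0 subr0.
suff H : h^-1 *: (flat_exp n (h *: 1 + 0) - flat_exp n 0) @[h --> (0 : R)^'] --> 0.
  by split; [apply/cvg_ex; exists 0|exact/cvg_lim].
apply/cvgrPdist_le => e e0; near=> h.
have h0 : h != 0 by near: h; exact: nbhs_dnbhs_neq.
rewrite sub0r normrN [flat_exp n 0]flat_exp_le0 // subr0 addr0 [h *: 1]mulr1.
rewrite normrM normfV ler_pdivrMl ?normr_gt0 //.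
apply: le_trans (flat_exp_bound n h) _.
rewrite -real_normK ?num_real // expr2 mulrCA ler_wpM2l //.
rewrite -ler_pdivlMl ?ltr0n ?fact_gt0 //.
near: h; apply: dnbhs0_le; rewrite mulr_gt0 // invr_gt0 ltr0n fact_gt0 //.
Unshelve. all: by end_near. Qed.

Lemma Ck_on_flat_exp m k (U : set 'rV[R]_m) q n :
  open U -> Ck_on k U q -> Ck_on k U (flat_exp n \o q).
Proof.
move=> oU; elim: k n => [|k IH] n cq;
  have cf x : U x -> {for x, continuous (flat_exp n \o q)} by
    move=> Ux; apply: continuous_comp; [exact: (Ck_on_continuous cq Ux)|
      apply/differentiable_continuous/derivable1_diffP;
      have [] := is_derive_flat_exp n (q x)].
  by split.
split=> // i.
have D x : U x -> is_derive x (delta_mx 0 i) (flat_exp n \o q)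
    ((flat_exp n.+2 (q x) - n%:R * flat_exp n.+1 (q x)) * 'D_(delta_mx 0 i) q x).
  move=> Ux; apply: is_derive_comp1 (is_derive_flat_exp n (q x)) _.
  exact/derivableP/(Ck_on_derivable cq Ux).
split=> [x /D[]//|].
have cq' := Ck_onW cq.
apply: (Ck_on_eq oU _ (Ck_onM oU (Ck_onB oU (IH n.+2 cq') (Ck_onM oU
  (Ck_on_cst k U n%:R) (IH n.+1 cq'))) (Ck_on_deriv i cq))).
by move=> x /D H; rewrite derive_val.
Qed.

End FlatFunction.

(** * Hadamard's lemma *)

Section Mean.
Context {R : realType}.
Implicit Types f g : R -> R.

Definition cont01 f := {within `[0, 1], continuous f}.

Lemma cont01_cst c : cont01 (cst c).
Proof. by move=> x; exact: cst_continuous. Qed.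

Lemma cont01D f g : cont01 f -> cont01 g -> cont01 (fun t => f t + g t).
Proof. by move=> cf cg x; apply: cvgD; [exact: cf|exact: cg]. Qed.

Lemma cont01B f g : cont01 f -> cont01 g -> cont01 (fun t => f t - g t).
Proof. by move=> cf cg x; apply: cvgB; [exact: cf|exact: cg]. Qed.

Lemma cont01M f g : cont01 f -> cont01 g -> cont01 (fun t => f t * g t).
Proof. by move=> cf cg x; apply: cvgM; [exact: cf|exact: cg]. Qed.

Definition mean01 f : R := \int[@lebesgue_measure R]_(t in `[0, 1]) f t.

Lemma integrable01 f : cont01 f ->
  (@lebesgue_measure R).-integrable `[0, 1] (EFin \o f).
Proof.
by move=> cf; apply: continuous_compact_integrable => //; exact: segment_compact.
Qed.

Lemma mean01_cst c : mean01 (cst c) = c.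
Proof.
rewrite /mean01 Rintegral_cst //= lebesgue_measure_itv /= lte_fin ltr01.
by rewrite oppr0 adde0 mulr1.
Qed.

Lemma mean01B f g : cont01 f -> cont01 g ->
  mean01 (fun t => f t - g t) = mean01 f - mean01 g.
Proof. by move=> cf cg; apply: RintegralB => //; exact: integrable01. Qed.

Lemma mean01Z a f : cont01 f -> mean01 (fun t => a * f t) = a * mean01 f.
Proof. by move=> cf; apply: RintegralZl => //; exact: integrable01. Qed.

Lemma mean01D f g : cont01 f -> cont01 g ->
  mean01 (fun t => f t + g t) = mean01 f + mean01 g.
Proof. by move=> cf cg; apply: RintegralD => //; exact: integrable01. Qed.

Lemma mean01_sum (I : Type) (s : seq I) (a : I -> R) (f : I -> R -> R) :
  (forall i, cont01 (f i)) ->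
  mean01 (fun t => \sum_(i <- s) a i * f i t) = \sum_(i <- s) a i * mean01 (f i).
Proof.
move=> cf.
have caf i : cont01 (fun t => a i * f i t).
  by apply: cont01M => //; exact: cont01_cst.
have cs (r : seq I) : cont01 (fun t => \sum_(i <- r) a i * f i t).
  elim: r => [|i r IH].
    by under eq_fun do rewrite big_nil; exact: cont01_cst.
  by under eq_fun do rewrite big_cons; exact: cont01D.
elim: s => [|i s IH].
  by under [X in mean01 X]eq_fun do rewrite big_nil; rewrite big_nil mean01_cst.
under [X in mean01 X]eq_fun do rewrite big_cons.
by rewrite mean01D // big_cons IH mean01Z.
Qed.

Lemma mean01_le f (e : R) : cont01 f -> (forall t : R, 0 <= t <= 1 -> `|f t| <= e) ->
  `|mean01 f| <= e.
Proof.
move=> cf fe; have If := integrable01 cf.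
apply: le_trans (le_normr_Rintegral _ If) _ => //.
rewrite -[leRHS](mean01_cst e) /mean01; apply: le_Rintegral => //.
- have cn : cont01 (fun t => `|f t|).
    by move=> x; apply: continuous_comp; [exact: cf|exact: norm_continuous].
  exact: integrable01.
- exact: (integrable01 (@cont01_cst e)).
Qed.

Lemma mean01_FTC f df : (forall t : R, 0 <= t <= 1 -> is_derive t 1 f (df t)) ->
  cont01 df -> mean01 df = f 1 - f 0.
Proof.
move=> dP cdf.
have d (t : R) : 0 <= t <= 1 -> {for t, continuous f}.
  by move=> /dP[dt _]; apply/differentiable_continuous/derivable1_diffP.
have := @continuous_FTC2 R df f 0 1 ltr01 cdf.
rewrite /mean01 /Rintegral => -> //.
- split.
  + by move=> t; rewrite in_itv /= => /andP[t0 t1]; have [] := dP t; rewrite ?ltW.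
  + apply: cvg_at_right_filter; apply: d; by rewrite lexx ler01.
  + apply: cvg_at_left_filter; apply: d; by rewrite lexx ler01.
- move=> t; rewrite in_itv /= => /andP[t0 t1].
  have t01 : 0 <= t <= 1 by rewrite !ltW.
  by rewrite derive1E; have [_] := dP t t01.
Qed.

End Mean.

Lemma continuous_distP {R : realType} (T : topologicalType) (f : T -> R) (x : T) :
  (forall e : R, 0 < e -> \forall y \near x, `|f y - f x| <= e) ->
  {for x, continuous f}.
Proof.
move=> H; apply/cvgrPdist_le => e e0.
by apply: filterS (H e e0) => y; rewrite distrC.
Qed.

Section StarShaped.
Context {R : realType} {m : nat}.
Variables (U : set 'rV[R]_m) (x0 : 'rV[R]_m).
Hypothesis oU : open U.
Implicit Types (f : 'rV[R]_m -> R) (x : 'rV[R]_m).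

Definition seg (x : 'rV[R]_m) (t : R) : 'rV[R]_m := x0 + t *: (x - x0).

Hypothesis starU : forall x (t : R), U x -> 0 <= t <= 1 -> U (seg x t).

Lemma seg_continuous : continuous (fun p : R * 'rV[R]_m => seg p.2 p.1).
Proof.
move=> p; rewrite /seg; apply: cvgD; first exact: cvg_cst.
apply: cvgZ; first exact: cvg_fst.
by apply: cvgB; [exact: cvg_snd|exact: cvg_cst].
Qed.

Lemma seg_cont01 f x : (forall y, U y -> {for y, continuous f}) -> U x ->
  cont01 (fun t => f (seg x t)).
Proof.
move=> cf Ux; apply: continuous_in_subspaceT => t; rewrite inE /= in_itv /= => t01.
apply: (@continuous_comp _ _ _ (seg x) f); last exact/cf/starU.
rewrite /seg; apply: cvgD; first exact: cvg_cst.
by apply: cvgZr_tmp; exact: cvg_id.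
Qed.

(** A tube lemma: joint continuity in (t, y) and compactness of [0, 1] yield one neighbourhood of x
    that serves all t. This uniformity replaces dominated convergence, both for continuity and for
    differentiation under the integral. *)
Lemma seg_tube f x (e : R) :
  (forall y, U y -> {for y, continuous f}) -> U x -> 0 < e ->
  \forall y \near x, U y /\
    forall t : R, 0 <= t <= 1 -> `|f (seg y t) - f (seg x t)| <= e.
Proof.
move=> cf Ux e0.
have cK : compact (`[0, 1] : set R) by exact: segment_compact.
have H : \forall y \near x, (`[0, 1] : set R) `<=`
    (fun t => `|f (seg y t) - f (seg x t)| <= e).
  apply: (iffLR (compact_near_coveringP _) cK _ (nbhs x)
    (fun y t => `|f (seg y t) - f (seg x t)| <= e)) => t /=.
  rewrite in_itv /= => t01.
  have cs : {for (t, x), continuous (fun p : R * 'rV[R]_m => f (seg p.2 p.1))}.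
    apply: (@continuous_comp _ _ _ (fun p : R * 'rV[R]_m => seg p.2 p.1) f).
      exact: seg_continuous.
    exact/cf/starU.
  have /cvgrPdist_le/(_ (e / 2)) := cs; rewrite divr_gt0 //.
  move=> /(_ isT) [[A B] /= [At Bx] AB].
  (* Both f(seg y u) and f(seg x u) are compared with f(seg x t), hence the e / 2. *)
  exists (A, B) => //= -[u y] /= [Au By].
  have h1 := AB (u, y) (conj Au By); have h2 := AB (u, x) (conj Au (nbhs_singleton Bx)).
  rewrite -(subrK (f (seg x t)) (f (seg y u))) -addrA (splitr e).
  by rewrite (le_trans (ler_normD _ _)) // lerD // distrC.
have nU : \forall y \near x, U y by exact: open_nbhs_nbhs.
by apply: filterS2 nU H => y Uy Hy; split.
Qed.

(* The weight t^n makes the family closed under differentiation: d/dx_j turns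
   (n, f) into (n + 1, d f / d x_j). *)
Definition seg_mean (n : nat) (f : 'rV[R]_m -> R) (x : 'rV[R]_m) : R :=
  mean01 (fun t => t ^+ n * f (seg x t)).

Lemma seg_mean_cont01 n f x : (forall y, U y -> {for y, continuous f}) -> U x ->
  cont01 (fun t => t ^+ n * f (seg x t)).
Proof.
move=> cf Ux; apply: cont01M; last exact: seg_cont01.
by apply: continuous_subspaceT; exact: exprn_continuous.
Qed.

Lemma seg_mean_continuous n f x : (forall y, U y -> {for y, continuous f}) ->
  U x -> {for x, continuous (seg_mean n f)}.
Proof.
move=> cf Ux; apply: continuous_distP => e e0.
apply: filterS (seg_tube cf Ux e0) => y [Uy H].
rewrite /seg_mean -mean01B; [|exact: seg_mean_cont01..].
apply: mean01_le => [|t t01].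
  by apply: cont01B; exact: seg_mean_cont01.
have /andP[t0 t1] := t01.
rewrite -mulrBr normrM ger0_norm ?exprn_ge0 //.
by rewrite (le_trans _ (H t t01)) // ler_piMl // exprn_ile1.
Qed.

(** Moving x by h v moves [seg x t] by (h t) v; the extra factor t raises the weight from t^n to
    t^(n+1). The mean value theorem under the integral and [seg_tube] for the partial derivative
    bound the error uniformly in t. *)
Lemma is_derive_seg_mean n f x j : Ck_on 1 U f -> U x ->
  is_derive x (delta_mx 0 j) (seg_mean n f)
    (seg_mean n.+1 ('D_(delta_mx 0 j) f) x).
Proof.
move=> cf Ux.
pose v : 'rV[R]_m := delta_mx 0 j; rewrite -/v.
have c0 y : U y -> {for y, continuous f} by exact: Ck_on_continuous cf.
have c1 y : U y -> {for y, continuous ('D_v f)}.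
  exact: (Ck_on_continuous (Ck_on_deriv j cf)).
suff H : h^-1 *: (seg_mean n f (h *: v + x) - seg_mean n f x) @[h --> (0 : R)^']
    --> seg_mean n.+1 ('D_v f) x.
  by split; [apply/cvg_ex; eexists; exact: H|exact/cvg_lim].
apply/cvgrPdist_le => e e0.
have /nbhs_ballP[r /= r0 rP] := seg_tube c1 Ux e0.
near=> h.
have h0 : h != 0 by near: h; exact: nbhs_dnbhs_neq.
have hr : `|h| < r by near: h; exact: dnbhs0_lt.
have By (c : R) : 0 <= c <= 1 -> ball x r ((c * h) *: v + x).
  move=> /andP[c0' c1']; split=> // i k.
  rewrite /ball /= !mxE opprD addrCA subrr addr0 normrN normrM.
  apply: le_lt_trans hr; rewrite normrM -[leRHS]mulr1 ler_pM //.
    by rewrite ger0_norm // ler_piMl.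
  by case: (_ && _); rewrite ?normr1 ?normr0.
have Uy : U (h *: v + x).
  by have := By 1; rewrite mul1r lexx ler01 => /(_ isT) /rP[].
have sE (c t : R) : seg (c *: v + x) t = seg x t + (c * t) *: v.
  by apply/rowP => i; rewrite !mxE; ring.
have Cy : cont01 (fun t => t ^+ n * f (seg (h *: v + x) t)).
  exact: seg_mean_cont01.
have Cx : cont01 (fun t => t ^+ n * f (seg x t)) by exact: seg_mean_cont01.
have Cd : cont01 (fun t => t ^+ n.+1 * 'D_v f (seg x t)).
  exact: (@seg_mean_cont01 n.+1 ('D_v f) x c1 Ux).
have Cq := cont01M (@cont01_cst R h^-1) (cont01B Cy Cx).
rewrite distrC.
rewrite -[_ *: (seg_mean _ _ _ - _)]/
  (h^-1 * (seg_mean n f (h *: v + x) - seg_mean n f x)).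
rewrite /seg_mean -(mean01B Cy Cx) -(mean01Z _ (cont01B Cy Cx)) -(mean01B Cq Cd).
apply: mean01_le => [|t t01]; first exact: cont01B.
have /andP[t0 t1] := t01.
(* The intermediate points seg x t + s (h t) v are the points [seg] at parameter t of x + (s h) v,
   which stays in the ball where [rP] applies. *)
have [s s01|a al E] := @mean_value_close R (fun u => f (seg x t + u *: v)) (h * t)
    ('D_v f (seg x t)) e (ltW e0).
  have [Us ds] := rP _ (By s s01); have := ds t t01; rewrite sE -mulrA => dl.
  have D : derivable f (seg x t + (s * (h * t)) *: v) v.
    by rewrite mulrA -sE; apply: (Ck_on_derivable cf); exact: starU.
  have D' := is_derive_line D.
  by split; [exact: ex_derive|rewrite derive_val].
rewrite scale0r addr0 in E; rewrite sE.
rewrite -mulrBr E.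
rewrite [X in `|X|](_ : _ = t ^+ n.+1 * (a - 'D_v f (seg x t))); last first.
  by rewrite exprS /cst; move: (t ^+ n) ('D_v f _) => u d; field.
rewrite normrM ger0_norm ?exprn_ge0 //.
by rewrite (le_trans _ al) // ler_piMl // exprn_ile1.
Unshelve. all: by end_near. Qed.

Lemma Ck_on_seg_mean k n f : Ck_on k U f -> Ck_on k U (seg_mean n f).
Proof.
elim: k n f => [|k IH] n f cf;
  have cs y : U y -> {for y, continuous (seg_mean n f)} by
    apply: seg_mean_continuous => z; exact: Ck_on_continuous cf.
  by split.
split=> // j.
have D x : U x -> is_derive x (delta_mx 0 j) (seg_mean n f)
    (seg_mean n.+1 ('D_(delta_mx 0 j) f) x).
  apply: is_derive_seg_mean; split=> [|i]; first by case: cf.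
  split=> [y|]; first exact: Ck_on_derivable cf.
  by have := Ck_on_deriv i cf; case: (k) => [|l] [].
split=> [x /D[]//|].
apply: (Ck_on_eq oU _ (IH n.+1 _ (Ck_on_deriv j cf))) => x /D H.
by rewrite derive_val.
Qed.

(** This is the fundamental theorem of calculus along the segment from x0 to x. The coefficients
    inherit the smoothness of the partial derivatives by [Ck_on_seg_mean]. *)
Lemma hadamard f x : Ck_on 1 U f -> U x ->
  f x = f x0 + \sum_i (x 0 i - x0 0 i) * seg_mean 0 ('D_(delta_mx 0 i) f) x.
Proof.
move=> cf Ux; rewrite /seg_mean.
have c0 i : cont01 (fun t => t ^+ 0 * 'D_(delta_mx 0 i) f (seg x t)).
  apply: (@seg_mean_cont01 0 ('D_(delta_mx 0 i) f)) => // y.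
  exact: (Ck_on_continuous (Ck_on_deriv i cf)).
rewrite -mean01_sum //.
suff -> : mean01 (fun t => \sum_i (x 0 i - x0 0 i) *
    (t ^+ 0 * 'D_(delta_mx 0 i) f (seg x t))) = (f \o seg x) 1 - (f \o seg x) 0.
  by rewrite /= /seg scale1r scale0r addr0 addrC subrK addrC subrK.
apply: mean01_FTC.
- move=> t t01.
  have D i : is_derive t 1 (fun s => seg x s 0 i) (x 0 i - x0 0 i).
    have -> : (fun s => seg x s 0 i) = cst (x0 0 i) + id * cst (x 0 i - x0 0 i).
      by apply/funext => s; rewrite !mxE.
    apply: (is_derive_eq (is_deriveD (is_derive_cst _ _ _)
      (is_deriveM (is_derive_id _ _) (is_derive_cst _ _ _)))).
    by rewrite scaler0 add0r [_ *: _]mulr1 add0r.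
  apply: is_derive_eq (@derive_comp_row R R m f (seg x) t 1 _ _ _) _.
  + near=> z => i; apply: (Ck_on_derivable cf).
    by near: z; apply: open_nbhs_nbhs; split=> //; exact: starU.
  + by move=> i; apply: (Ck_on_continuous (Ck_on_deriv i cf)); exact: starU.
  + by move=> i; have [] := D i.
  + by apply: eq_bigr => i _; rewrite derive_val expr0 mul1r.
- move=> s; apply: cvg_big => [|i _]; first exact: add_continuous.
  by apply: cvgM; [exact: cvg_cst|exact: c0].
Unshelve. all: by end_near. Qed.

End StarShaped.

(** * Local frames *)

Lemma open_preimage_on (T T' : topologicalType) (A : set T) (B : set T') (f : T -> T') :
  open A -> open B -> (forall x, A x -> {for x, continuous f}) ->
  open (A `&` f @^-1` B).
Proof.
move=> oA oB cf; rewrite openE => x [Ax Bx]; apply: filterI.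
  exact: open_nbhs_nbhs.
by apply: (cf x Ax); exact: open_nbhs_nbhs.
Qed.

Lemma addr_self_eq0 (U : zmodType) (x : U) : x = x + x -> x = 0.
Proof. by rewrite -[x in LHS]addr0 => /addrI. Qed.

Section Manifold.
Context {R : realType} {m : nat} (M : smooth_manifold R m).
Local Notation C := (Cinf M).
Local Notation V := (vfield M).

Lemma Cinf_smoothP (f : C) : smooth f.
Proof. by have /asboolP := Cinf_smooth f. Qed.

Lemma smooth_Cinf (F : M -> R) : smooth F -> exists f : C, f = F :> (M -> R).
Proof. by move=> /asboolP sF; exists (MkCinf sF). Qed.

(** Smoothness is local, and d != 0 is an open condition satisfied at p. This is how functions given
    by different quotients near different points are recognized as smooth. *)
Lemma smooth_quotient (F : M -> R) :
  (forall p, exists n d : C, d p != 0 /\ forall q, d q != 0 -> F q = n q / d q) ->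
  smooth F.
Proof.
move=> H c ac k; apply: Ck_on_local => y cy.
have [n [d [dp E]]] := H (chart_inv c y).
have oc := chart_img_open c.
have sd := Cinf_smoothP d ac k; have sn := Cinf_smoothP n ac k.
exists (chart_img c `&` (d \o chart_inv c) @^-1` [set r | r != 0]).
have oN : open (chart_img c `&` (d \o chart_inv c) @^-1` [set r | r != 0]).
  have on : open [set r : R | r != 0] by exact: open_neq.
  apply: open_preimage_on => // x.
  exact: Ck_on_continuous sd.
split=> //.
have sub : chart_img c `&` (d \o chart_inv c) @^-1` [set r | r != 0] `<=` chart_img c.
  by move=> ? [].
apply: (Ck_on_eq oN _ (Ck_onM oN (Ck_on_sub sub sn)
  (Ck_onV oN _ (Ck_on_sub sub sd)))) => x [_ dx]; last exact: dx.
by rewrite /= E.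
Qed.

Section Chart.
Variables (c : chart R m M) (O K : set 'rV[R]_m).
Hypotheses (ac : atlas c) (oO : open O) (sO : O `<=` chart_img c).
Hypotheses (cK : compact K) (KO : K `<=` O).

Definition zero_ext (F : 'rV[R]_m -> R) (q : M) : R :=
  if `[< chart_dom c q /\ O (chart_map c q) >] then F (chart_map c q) else 0.

(** Inside the region the function is F composed with a change of charts. Any other point lies
    outside the image of K, which is compact and hence closed because M is Hausdorff; near such a
    point the function vanishes. *)
Lemma zero_ext_smooth F : smooth_on O F -> (forall x, O x -> ~ K x -> F x = 0) ->
  smooth (zero_ext F).
Proof.
move=> sF F0 d ad k; apply: Ck_on_local => y dy.
have od := chart_img_open d; have odc := chart_dom_open c.
have ci := chart_inv_continuous (c := d).
have [[h1 h2]|h] := pselect (chart_dom c (chart_inv d y) /\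
    O (chart_map c (chart_inv d y))).
  set N1 := chart_img d `&` chart_inv d @^-1` chart_dom c.
  have oN1 : open N1 by apply: open_preimage_on.
  have st i : smooth_on N1 (fun x => chart_map c (chart_inv d x) 0 i).
    exact: atlas_compatible.
  have ct x : N1 x -> {for x, continuous (chart_map c \o chart_inv d)}.
    by move=> N1x; apply: continuous_row => i; exact: (Ck_on_continuous (st i 0%N) N1x).
  set N := N1 `&` (chart_map c \o chart_inv d) @^-1` O.
  have oN : open N by exact: open_preimage_on.
  exists N; split=> //.
  have := @Ck_on_comp R m m k O N F (chart_map c \o chart_inv d) oO oN.
  move=> /(_ (fun y Ny => Ny.2) (fun i => Ck_on_sub (@subIsetl _ _ _) (st i k)) (sF k)).
  apply: Ck_on_eq => // x [[_ x1] x2]; rewrite /= /zero_ext.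
  by case: asboolP => // -[].
set N := chart_img d `&` chart_inv d @^-1` (~` (chart_inv c @` K)).
have cl : closed (chart_inv c @` K).
  apply: compact_closed; first exact: manifold_hausdorff.
  apply: continuous_compact => //; apply: continuous_in_subspaceT => x.
  by rewrite inE => /KO/sO; exact: chart_inv_continuous.
have oN : open N by apply: open_preimage_on => //; exact: closed_openC.
exists N; split.
  split=> // -[x Kx E]; apply: h; rewrite -E; split.
    by apply: chart_inv_dom; exact/sO/KO.
  by rewrite chart_invK; [exact: KO|exact/sO/KO].
apply: Ck_on_eq (Ck_on_cst k N 0) => // x [dx nx]; rewrite /= /zero_ext.
case: asboolP => // -[x1 x2]; rewrite F0 // => Kx; apply: nx.
by exists (chart_map c (chart_inv d x)) => //; rewrite chart_mapK.
Qed.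

Lemma zero_ext_in F q : chart_dom c q -> O (chart_map c q) ->
  zero_ext F q = F (chart_map c q).
Proof. by move=> cq Oq; rewrite /zero_ext; case: asboolP => // -[]. Qed.

Lemma zero_ext_factor F H q :
  zero_ext (fun x => F x * H x) q = zero_ext F q * H (chart_map c q).
Proof. by rewrite /zero_ext; case: ifP => // _; rewrite mul0r. Qed.

End Chart.

Lemma vfieldD (X Y : V) h : (X + Y) h = (X h : C) + Y h. Proof. by []. Qed.
Lemma vfieldN (X : V) h : (- X) h = - (X h : C). Proof. by []. Qed.
Lemma vfieldZ (f : C) (X : V) h : (f *: X) h = f * (X h : C). Proof. by []. Qed.

Lemma vfield_sum (I : Type) (r : seq I) (X : I -> V) h :
  (\sum_(i <- r) X i) h = \sum_(i <- r) (X i h : C).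
Proof.
by elim: r => [|i r IH]; rewrite ?big_nil // !big_cons vfieldD IH.
Qed.

Lemma vfield_ext (X Y : V) : (forall h, X h = Y h :> C) -> X = Y.
Proof. by move=> E; apply/val_inj/funext. Qed.

Lemma derivD (X : V) (f h : C) : X (f + h) = (X f : C) + X h.
Proof. by have /asboolP[XD _] := vfieldP X; rewrite -[f in LHS]scale1r XD scale1r. Qed.

Lemma derivM (X : V) (f h : C) : X (f * h) = (X f : C) * h + f * (X h : C).
Proof. by have /asboolP[_ XM] := vfieldP X; rewrite XM. Qed.

Lemma deriv0 (X : V) : X 0 = 0 :> C.
Proof. by apply: (@addr_self_eq0 C); rewrite -derivD addr0. Qed.

Lemma derivZ (X : V) a (f : C) : X (a *: f) = a *: (X f : C).
Proof. by have /asboolP[XD _] := vfieldP X; rewrite -[a *: f]addr0 XD deriv0 addr0. Qed.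

Lemma derivN (X : V) (f : C) : X (- f) = - (X f : C).
Proof. by rewrite -scaleN1r derivZ scaleN1r. Qed.

Lemma deriv_sum (X : V) (I : Type) (r : seq I) (f : I -> C) :
  X (\sum_(i <- r) f i) = \sum_(i <- r) (X (f i) : C).
Proof.
by elim: r => [|i r IH]; rewrite ?big_nil ?deriv0 // !big_cons derivD IH.
Qed.

Lemma Cinf_sumE (I : Type) (r : seq I) (f : I -> C) p :
  (\sum_(i <- r) f i) p = \sum_(i <- r) f i p.
Proof. by elim: r => [|i r IH]; rewrite ?big_nil // !big_cons CinfD IH. Qed.

(* The coordinate fields of a chart, multiplied by a bump function chi so as to
   be defined on all of M. The components of X in this frame are those of
   chi X(x^j) = X(chi x^j) - x^j X(chi), in which chi x^j is smooth on M. *)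
Lemma local_frame (p : M) : exists (chi : C) (x : 'I_m -> C) (e : 'I_m -> V),
  [/\ chi p != 0,
      forall X : V, chi ^+ 3 *: X =
        \sum_i (chi * (X (x i) : C) - x i * (X chi : C)) *: e i &
      forall i j, chi * (e i (x j) : C) - x j * (e i chi : C) = chi ^+ 3 *+ (i == j)].
Proof.
have [c ac cp] := atlas_cover p.
have oc := chart_img_open c.
pose a := chart_map c p.
have [r0 /= r00 ballc] : exists2 r : R, 0 < r & ball a r `<=` chart_img c.
  by apply/nbhs_ballP; apply: open_nbhs_nbhs; split=> //; exact: chart_map_img.
(* Balls of row vectors are sup-norm cubes, so the closed cube K of half the radius fits into O. *)
pose r := r0 / 2.
have r_gt0 : 0 < r by rewrite divr_gt0.
pose O := ball a r0.
pose K := [set v : 'rV[R]_m | forall i, `[a 0 i - r, a 0 i + r]%classic (v ord0 i)].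
have oO : open O by exact: ball_open.
have cK : compact K.
  apply: (@rV_compact R m (fun i => `[a 0 i - r, a 0 i + r]%classic)) => i.
  exact: segment_compact.
have KO : K `<=` O.
  move=> v Kv; split=> // i j; rewrite (ord1 i) /ball /=.
  have := Kv j; rewrite /= in_itv /= => /andP[h1 h2].
  have : r < r0 by rewrite /r ltr_pdivrMr // ltr_pMr // ltr1n.
  by move=> ?; rewrite ltr_norml; apply/andP; split; lra.
(* The i-th factor is positive exactly when |y_i - a_i| < r: a bump function that is positive at a
   and vanishes off K. *)
pose rho (y : 'rV[R]_m) := \prod_i flat_exp 0 (r ^+ 2 - (y 0 i - a 0 i) ^+ 2).
have srho k U : open U -> Ck_on k U rho.
  move=> oU; apply: Ck_on_prod => // i.
  apply: (@Ck_on_flat_exp R m k U (fun y => r ^+ 2 - (y 0 i - a 0 i) ^+ 2)) => //.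
  have ci : Ck_on k U (fun y : 'rV[R]_m => y 0 i - a 0 i).
    by apply: Ck_onB => //; [exact: Ck_on_coord|exact: Ck_on_cst].
  have := Ck_onB oU (Ck_on_cst k U (r ^+ 2)) (Ck_onM oU ci ci).
  by apply: Ck_on_eq => // y _; rewrite !fctE /= expr2.
have rho0 y : ~ K y -> rho y = 0.
  move=> Ky; have [i yi] : exists i, r <= `|y 0 i - a 0 i|.
    apply: contrapT => H; apply: Ky => i /=; rewrite in_itv /=.
    have : ~ (r <= `|y 0 i - a 0 i|) by move=> h; apply: H; exists i.
    move=> /negP; rewrite -ltNge ltr_norml => /andP[h1 h2].
    by apply/andP; split; lra.
  rewrite /rho (bigD1 i) //= flat_exp_le0 ?mul0r // subr_le0.
  by rewrite -[leRHS]real_normK ?num_real // lerXn2r // nnegrE ltW.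
have ext F : smooth_on O F -> exists h : C,
    forall q, h q = zero_ext c O (fun y => rho y * F y) q.
  move=> sF; have [|h hE] := @smooth_Cinf (zero_ext c O (fun y => rho y * F y)).
    apply: (zero_ext_smooth ac oO ballc cK KO) => [k|y _ Ky].
      by apply: Ck_onM => //; exact: srho.
    by rewrite rho0 // mul0r.
  by exists h => q; rewrite -hE.
have [chi chiE0] : exists h : C, forall q, h q = zero_ext c O rho q.
  have [|h hE] := ext (cst 1); first by move=> k; exact: Ck_on_cst.
  exists h => q; rewrite hE; congr (zero_ext c O _ q).
  by apply/funext => y; rewrite mulr1.
have extE F : smooth_on O F -> exists h : C,
    forall q, h q = chi q * F (chart_map c q).
  move=> /ext[h hE]; exists h => q; rewrite hE chiE0 zero_ext_factor //.
have chi_in q : chi q != 0 -> chart_dom c q /\ O (chart_map c q).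
  by rewrite chiE0 /zero_ext; case: asboolP => //; rewrite eqxx.
have /choice[x xE] : forall i : 'I_m, exists h : C,
    forall q, h q = chi q * (chart_map c q) 0 i.
  by move=> i; apply: (extE (fun y => y 0 i)) => k; exact: Ck_on_coord.
have sinv (h : C) k : Ck_on k O (h \o chart_inv c).
  exact: Ck_on_sub ballc (Cinf_smoothP h ac k).
have sD (h : C) i : smooth_on O ('D_(delta_mx 0 i) (h \o chart_inv c)).
  by move=> k; exact: Ck_on_deriv (sinv h k.+1).
have /choice[D DE] : forall ih : 'I_m * C, exists h : C, forall q,
    h q = chi q * 'D_(delta_mx 0 ih.1) (ih.2 \o chart_inv c) (chart_map c q).
  by move=> [i h]; exact: (extE _ (sD h i)).
have Dv (h : C) i y : O y -> derivable (h \o chart_inv c) y (delta_mx 0 i).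
  exact: Ck_on_derivable (sinv h 1%N).
have eP i : (fun h => D (i, h)) \in @derivation_pred R m M.
  apply/asboolP; split=> [b f h|f h]; apply: CinfP => q;
    rewrite !CinfE !DE /=; have [->|/chi_in[dq Oq]] := eqVneq (chi q) 0;
    try by rewrite !(mul0r, mulr0, addr0).
    have -> : (b *: f + h) \o chart_inv c =
      b *: (f \o chart_inv c) + (h \o chart_inv c) by [].
    rewrite deriveD; [|by apply: derivableZ; exact: Dv|exact: Dv].
    rewrite deriveZ; last exact: Dv.
    by rewrite mulrDr /GRing.scale /= mulrCA.
  have cq : chart_inv c (chart_map c q) = q.
    by rewrite chart_mapK.
  have -> : (f * h) \o chart_inv c = (f \o chart_inv c) * (h \o chart_inv c) by [].
  rewrite deriveM; [|exact: Dv|exact: Dv].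
  rewrite /= cq /GRing.scale /=; ring.
pose e i : V := MkVfield (eP i).
have eE i h q : (e i h : C) q =
    chi q * 'D_(delta_mx 0 i) (h \o chart_inv c) (chart_map c q).
  by rewrite -[RHS](DE (i, h)).
exists chi, x, e; split.
- rewrite chiE0 zero_ext_in // ?prodf_neq0 => [|]; last exact: ballxx.
  apply/prodf_neq0 => i _; rewrite gt_eqF // flat_exp_gt0 //.
  by rewrite subrr expr0n /= subr0 exprn_gt0.
- move=> X; apply: vfield_ext => h; apply: CinfP => q.
  rewrite vfieldZ vfield_sum !CinfE Cinf_sumE.
  have [c0|cq] := eqVneq (chi q) 0.
    rewrite c0 !mul0r big1 // => i _.
    by rewrite vfieldZ CinfM eE c0 mul0r mulr0.
  have [dq Oq] := chi_in q cq.
  set x0 := chart_map c q in Oq.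
  (* Hadamard's lemma is centred at the image of the point q under consideration, not at that of p;
     the cube is star-shaped about each of its points. *)
  have star (y : 'rV[R]_m) (t : R) : O y -> 0 <= t <= 1 -> O (seg x0 y t).
    move=> [_ Oy] t01; split=> // i j; rewrite /ball /= !mxE.
    by apply: dist_convex => //; [have [_ Ox0] := Oq; exact: Ox0|exact: Oy].
  pose H i := seg_mean x0 0 ('D_(delta_mx 0 i) (h \o chart_inv c)).
  have /choice[hh hhE] : forall i, exists f : C,
      forall q, f q = chi q * H i (chart_map c q).
    by move=> i; apply: extE => k; apply: Ck_on_seg_mean => //; exact: sD.
  have Hx0 i : H i x0 = 'D_(delta_mx 0 i) (h \o chart_inv c) x0.
    rewrite /H /seg_mean -[RHS]mean01_cst; congr mean01; apply/funext => t.
    by rewrite expr0 mul1r /seg subrr scaler0 addr0.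
  (* Hadamard's expansion times chi^2, one factor for each of x_i - x0_i and H_i, so that every term
     is a global smooth function. When X is applied and the result evaluated at q, the factors x_i -
     x0_i chi vanish and only their derivatives survive. A third factor chi then turns x0_i chi into
     x_i, hence the cube in the statement. *)
  have E : chi * chi * h =
      (h q) *: (chi * chi) + \sum_i (x i - x0 0 i *: chi) * hh i.
    apply: CinfP => q'; rewrite !CinfE Cinf_sumE.
    have [c0'|cq'] := eqVneq (chi q') 0.
      rewrite c0' !mul0r mulr0 add0r big1 // => i _.
      by rewrite !CinfE xE hhE c0' !mul0r mulr0.
    have [dq' Oq'] := chi_in q' cq'.
    have := hadamard oO star (sinv h 1%N) Oq'.
    rewrite /= !chart_mapK // => ->.
    rewrite mulrDr [_ * h q]mulrC mulr_sumr; congr (_ + _); apply: eq_bigr => i _.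
    rewrite -/(H i _) -[RHS]/((x i q' - x0 0 i * chi q') * hh i q') xE hhE; ring.
  have := congr1 (fun f : C => (X f : C) q) E.
  rewrite derivM derivM derivD derivZ derivM deriv_sum !CinfE Cinf_sumE.
  have -> : \sum_i (X ((x i - x0 0 i *: chi) * hh i) : C) q =
      \sum_i ((X (x i) : C) q - x0 0 i * (X chi : C) q) * (chi q * H i x0).
    apply: eq_bigr => i _.
    rewrite derivM derivD derivN derivZ !CinfE xE hhE -/x0; ring.
  rewrite [h q * _]mulrC => /addrI E'.
  rewrite -mulrA E' mulr_sumr; apply: eq_bigr => i _.
  rewrite vfieldZ !CinfE eE xE -/x0 Hx0; ring.
(* Where chi is nonzero the left side is, by the quotient rule, chi^2 e_i(x_j / chi), and x_j / chi
   is the j-th coordinate. *)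
- move=> i j; apply: CinfP => q.
  have [c0|cq] := eqVneq (chi q) 0.
    rewrite !CinfE !eE xE c0 !(mul0r, mulr0) subr0.
    by case: (i == j); rewrite ?mulr0n // mulr1n exprS CinfM c0 mul0r.
  have [dq Oq] := chi_in q cq.
  rewrite !CinfE !eE xE.
  set y := chart_map c q in Oq *.
  have Oinv y' : O y' -> chart_dom c (chart_inv c y') /\
      chart_map c (chart_inv c y') = y'.
    by move=> /ballc cy; split; [exact: chart_inv_dom|exact: chart_invK].
  have chiI y' : O y' -> chi (chart_inv c y') = rho y'.
    by move=> Oy; have [h1 h2] := Oinv y' Oy; rewrite chiE0 zero_ext_in // h2.
  have drho : derivable rho y (delta_mx 0 i) by exact: Ck_on_derivable (srho 1%N O oO) Oq.
  have dco := is_derive_coord j i y.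
  have -> : 'D_(delta_mx 0 i) (chi \o chart_inv c) y = 'D_(delta_mx 0 i) rho y.
    apply: near_eq_derive; apply: (@near_open_eq R m O (chi \o chart_inv c) rho) => //.
  have -> : 'D_(delta_mx 0 i) (x j \o chart_inv c) y =
      'D_(delta_mx 0 i) (rho * (fun y : 'rV[R]_m => y 0 j)) y.
    apply: near_eq_derive.
    apply: (@near_open_eq R m O (x j \o chart_inv c)) => // y' Oy'.
    by rewrite /= xE chiI //; have [_ ->] := Oinv y' Oy'.
  have dcd : derivable (fun y : 'rV[R]_m => y 0 j) y (delta_mx 0 i) by case: dco.
  rewrite (deriveM drho dcd) (derive_val (is_derive := dco)) eq_sym /GRing.scale /=.
  have -> : rho y = chi q by rewrite chiE0 zero_ext_in.
  have -> : (chi ^+ 3 *+ (i == j)) q = chi q * (chi q * chi q) * (i == j)%:R.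
    by case: (i == j); rewrite ?mulr1 ?mulr0.
  ring.
Qed.

End Manifold.

(** * The Riesz isomorphism of a Riemannian metric *)

Section Metric.
Context {R : realType} {m : nat} {M : smooth_manifold R m}.
Local Notation C := (Cinf M).
Local Notation V := (vfield M).
Variable g : riemannian_metric M.
Implicit Types (X Y Z : V) (f : C).

Lemma metricDl X Y Z : g (X + Y) Z = g X Z + g Y Z.
Proof. by rewrite -[X in LHS]scale1r metric_linear mul1r. Qed.

Lemma metric0l Z : g 0 Z = 0.
Proof. by apply: addr_self_eq0; rewrite -metricDl addr0. Qed.

Lemma metricZl f X Z : g (f *: X) Z = f * g X Z.
Proof. by rewrite -[f *: X]addr0 metric_linear metric0l addr0. Qed.

Lemma metricNl X Z : g (- X) Z = - g X Z.
Proof. by rewrite -scaleN1r metricZl mulN1r. Qed.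

Lemma metricDr X Y Z : g Z (X + Y) = g Z X + g Z Y.
Proof. by rewrite !(metric_sym g Z) metricDl. Qed.

Lemma metric0r Z : g Z 0 = 0.
Proof. by rewrite metric_sym metric0l. Qed.

Lemma metricZr f X Z : g Z (f *: X) = f * g Z X.
Proof. by rewrite !(metric_sym g Z) metricZl. Qed.

Lemma metricNr X Z : g Z (- X) = - g Z X.
Proof. by rewrite !(metric_sym g Z) metricNl. Qed.

Lemma metric_suml (I : Type) (r : seq I) (X : I -> V) Z :
  g (\sum_(i <- r) X i) Z = \sum_(i <- r) g (X i) Z.
Proof. by elim: r => [|i r IH]; rewrite ?big_nil ?metric0l // !big_cons metricDl IH. Qed.

Lemma metric_sumr (I : Type) (r : seq I) (X : I -> V) Z :
  g Z (\sum_(i <- r) X i) = \sum_(i <- r) g Z (X i).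
Proof. by rewrite metric_sym metric_suml; apply: eq_bigr => i _; rewrite metric_sym. Qed.

Lemma metric_nondegenerate X : (forall Y, g X Y = 0) -> X = 0.
Proof.
move=> H; apply: vfield_ext => f; apply: CinfP => p.
by rewrite (metric_definite (r := g)) // H.
Qed.

Lemma metric_inj X Y : (forall Z, g X Z = g Y Z) -> X = Y.
Proof.
move=> E; apply/eqP; rewrite -subr_eq0; apply/eqP/metric_nondegenerate => Z.
by rewrite metricDl metricNl E subrr.
Qed.

Section Riesz.
Variable w : V -> C.
Hypothesis wP : forall f X Y, w (f *: X + Y) = f * w X + w Y.

Let wD X Y : w (X + Y) = w X + w Y.
Proof. by rewrite -[X in LHS]scale1r wP mul1r. Qed.

Let w0 : w 0 = 0.
Proof. by apply: addr_self_eq0; rewrite -wD addr0. Qed.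

Let wZ f X : w (f *: X) = f * w X.
Proof. by rewrite -[f *: X]addr0 wP w0 addr0. Qed.

Let w_sum (I : Type) (r : seq I) (X : I -> V) :
  w (\sum_(i <- r) X i) = \sum_(i <- r) w (X i).
Proof. by elim: r => [|i r IH]; rewrite ?big_nil ?w0 // !big_cons wD IH. Qed.

Lemma Cinf_prodE (I : Type) (r : seq I) (f : I -> C) p :
  (\prod_(i <- r) f i) p = \prod_(i <- r) f i p.
Proof. by elim: r => [|i r IH]; rewrite ?big_nil // !big_cons CinfM IH. Qed.

Lemma Cinf_detE k (A : 'M[C]_k) p : (\det A) p = \det (map_mx (fun f : C => f p) A).
Proof.
rewrite /determinant Cinf_sumE; apply: eq_bigr => s _.
rewrite CinfM Cinf_prodE; congr (_ * _); last by apply: eq_bigr => i _; rewrite mxE.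
by case: (odd_perm s); rewrite ?expr0 ?expr1.
Qed.

Lemma riesz_local (p : M) : exists (Z : V) (d : C), d p != 0 /\
  forall X, g Z X = d * w X.
Proof.
have [chi [x [e [chip frame dual]]]] := local_frame p.
pose B i X : C := chi * (X (x i) : C) - x i * (X chi : C).
pose G := \matrix_(i < m, j < m) g (e i) (e j).
pose b := \row_j w (e j).
(* The adjugate solves the Gram system up to the factor det G without dividing in C^oo(M). *)
pose c := b *m \adj G.
pose Z0 := \sum_i c 0 i *: e i.
have gZ0 j : g Z0 (e j) = \det G * w (e j).
  have : (b *m \adj G *m G) 0 j = \det G * w (e j).
    by rewrite -mulmxA mul_adj_mx mul_mx_scalar !mxE.
  rewrite -/c mxE => <-; rewrite metric_suml; apply: eq_bigr => i _.
  by rewrite metricZl [G _ _]mxE.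
exists (chi ^+ 3 *: Z0), (chi ^+ 3 * \det G); split; last first.
  move=> X; rewrite metricZl -mulrA mulrCA -wZ -metricZr frame.
  rewrite metric_sumr w_sum mulr_sumr; apply: eq_bigr => i _.
  by rewrite metricZr wZ gZ0 mulrCA.
have chi3 : (chi ^+ 3) p != 0.
  by rewrite -[(chi ^+ 3) p]/(chi p * (chi p * chi p)) !mulf_neq0.
rewrite CinfM mulf_neq0 // Cinf_detE.
(* A kernel vector v of the Gram matrix at p gives a field Y = sum_i v_i e_i of length 0 at p.
   Definiteness makes Y vanish at p, and pairing with the dual forms [B j] returns chi(p)^3 v_j =
   0. *)
apply/negP => /det0P[v v0 vG].
pose Y := \sum_i (v 0 i *: (1 : C)) *: e i.
have gY : g Y Y p = 0.
  rewrite metric_sumr Cinf_sumE big1 // => j _.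
  rewrite metricZr metric_suml CinfM Cinf_sumE.
  suff -> : \sum_i (g ((v 0 i *: (1 : C)) *: e i) (e j)) p =
      (v *m map_mx (fun f : C => f p) G) 0 j.
    by rewrite vG mxE mulr0.
  rewrite mxE; apply: eq_bigr => i _.
  by rewrite metricZl CinfM CinfZ Cinf1 mulr1 !mxE.
have Y0 := metric_definite gY.
have dualB i j : B j (e i) = chi ^+ 3 *+ (i == j) := dual i j.
move/eqP: v0; apply; apply/rowP => j; rewrite mxE.
have : (B j Y) p = 0 by rewrite !CinfE !Y0 !mulr0 subrr.
have -> : B j Y = \sum_i (v 0 i *: (1 : C)) * B j (e i).
  rewrite /B !vfield_sum !mulr_sumr -sumrB; apply: eq_bigr => i _.
  rewrite !vfieldZ; ring.
rewrite Cinf_sumE (bigD1 j) // big1 => [|i ij]; last first.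
  by rewrite CinfM dualB (negbTE ij) mulr0n Cinf0 mulr0.
rewrite [X in X = _]addr0 dualB eqxx mulr1n CinfM CinfZ Cinf1 mulr1 => /eqP.
by rewrite mulf_eq0 (negbTE chi3) orbF => /eqP.
Qed.

(* Two local solutions agree after cross-multiplication because g is definite,
   so the quotients patch together without a partition of unity. *)
Lemma riesz : exists Z, forall X, g Z X = w X.
Proof.
have /choice[n /choice[d nd]] := riesz_local.
have agree p q : d q *: n p = d p *: n q.
  apply: metric_inj => X; rewrite !metricZl.
  by rewrite (nd p).2 (nd q).2 mulrCA.
(* At each q the solution chosen at q is divided by the number [d q q], so the derivation rules for
   Z hold point by point. By [agree], the solution chosen at p computes the same values wherever
   [d p] is nonzero, which gives smoothness. *)
pose F h q : R := (n q h : C) q / d q q.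
have dq q : d q q != 0 := (nd q).1.
have FE h p q : (n p h : C) q = d p q * F h q.
  have := agree p q => /(congr1 (fun X : V => (X h : C) q)).
  rewrite !vfieldZ !CinfM /F => E.
  by rewrite mulrA -E mulrAC mulfV ?mul1r.
have sF h : smooth (F h).
  apply: smooth_quotient => p; exists (n p h), (d p); split=> // q dpq.
  by rewrite FE mulrAC mulfV ?mul1r.
pose Zf h : C := MkCinf (asboolT (sF h)).
have ZE h q : Zf h q = (n q h : C) q / d q q by [].
have ZP : Zf \in @derivation_pred R m M.
  apply/asboolP; split=> [a f h|f h]; apply: CinfP => q; rewrite !CinfE !ZE.
    by rewrite derivD derivZ !CinfE mulrDl mulrA.
  by rewrite derivM !CinfE mulrDl mulrA mulrAC.
pose Z : V := MkVfield ZP.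
exists Z => X; apply: CinfP => p.
have dZ : d p *: Z = n p.
  by apply: vfield_ext => h; apply: CinfP => q; rewrite vfieldZ CinfM FE.
apply: (mulfI (dq p)); rewrite -!CinfM -metricZl dZ (nd p).2 //.
Qed.

End Riesz.
End Metric.

(** * Connections with prescribed torsion *)

Section Brackets.
Context {R : realType} {m : nat} {M : smooth_manifold R m}.
Local Notation C := (Cinf M).
Local Notation V := (vfield M).
Implicit Types (X Y Z : V) (f : C).

Lemma lie_anti X Y : lie_bracket Y X = - lie_bracket X Y.
Proof. by apply: vfield_ext => h; rewrite vfieldN opprB. Qed.

Lemma lie_self X : lie_bracket X X = 0.
Proof. by apply: vfield_ext => h; rewrite -[LHS]/((_ : C) - _) subrr. Qed.

Lemma lieDr X Y Z : lie_bracket X (Y + Z) = lie_bracket X Y + lie_bracket X Z.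
Proof.
apply: vfield_ext => h; rewrite vfieldD.
rewrite -[LHS]/((X ((Y h : C) + Z h) : C) - ((Y (X h) : C) + Z (X h))) derivD.
by rewrite opprD addrACA.
Qed.

Lemma lieZr X f Y : lie_bracket X (f *: Y) = (X f : C) *: Y + f *: lie_bracket X Y.
Proof.
apply: vfield_ext => h; rewrite vfieldD !vfieldZ.
rewrite -[LHS]/((X (f * (Y h : C)) : C) - f * (Y (X h) : C)) derivM.
by rewrite -[lie_bracket X Y h]/((X (Y h) : C) - Y (X h)) mulrBr addrA.
Qed.

Lemma lieDl X Y Z : lie_bracket (Y + Z) X = lie_bracket Y X + lie_bracket Z X.
Proof. by rewrite lie_anti lieDr opprD -!lie_anti. Qed.

Lemma lieZl X f Y : lie_bracket (f *: Y) X = f *: lie_bracket Y X - (X f : C) *: Y.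
Proof. by rewrite lie_anti lieZr opprD addrC -[X in X - _]scalerN -lie_anti. Qed.

Variable g : riemannian_metric M.

Lemma Cinf_half (f : C) p : (Cinf_const M 2^-1 * f) p = 2^-1 * f p.
Proof. by rewrite CinfM CinfZ Cinf1 mulr1. Qed.

(** Polarization of t(X + Y, X + Y, Z) = 0; the closure hypothesis on E keeps X + Y in the domain
    where t is a form. *)
Lemma three_form_swap12 (E : set V) (t : V -> V -> V -> C) X Y Z :
  (forall U W, E U -> E W -> E (1 *: U + W)) -> three_form_on E t ->
  E X -> E Y -> E Z -> t Y X Z = - t X Y Z.
Proof.
move=> ED [t1 t2 _ t0] eX eY eZ; have eXY := ED X Y eX eY.
have [A1 _ _] := t0 _ Z eXY eZ; have [A2 _ _] := t0 X Z eX eZ.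
have [A3 _ _] := t0 Y Z eY eZ.
move: A1; rewrite t1 // !t2 // A2 A3 !mul1r addr0 add0r.
by move/eqP; rewrite addr_eq0 => /eqP ->; rewrite opprK.
Qed.

Lemma three_form_swap23 (E : set V) (t : V -> V -> V -> C) X Y Z :
  (forall U W, E U -> E W -> E (1 *: U + W)) -> three_form_on E t ->
  E X -> E Y -> E Z -> t X Z Y = - t X Y Z.
Proof.
move=> ED [_ t2 t3 t0] eX eY eZ; have eYZ := ED Y Z eY eZ.
have [_ _ A1] := t0 _ X eYZ eX; have [_ _ A2] := t0 Y X eY eX.
have [_ _ A3] := t0 Z X eZ eX.
move: A1; rewrite t2 // !t3 // A2 A3 !mul1r addr0 add0r.
by move/eqP; rewrite addr_eq0 => /eqP ->; rewrite opprK.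
Qed.

Section ThreeForms.
Variable T : V -> V -> V -> C.
Hypothesis TP : three_form_on setT T.

Lemma form_linear1 f X Y Z W : T (f *: X + Y) Z W = f * T X Z W + T Y Z W.
Proof. by have [H _ _ _] := TP; exact: H. Qed.
Lemma form_linear2 f X Y Z W : T Z (f *: X + Y) W = f * T Z X W + T Z Y W.
Proof. by have [_ H _ _] := TP; exact: H. Qed.
Lemma form_linear3 f X Y Z W : T Z W (f *: X + Y) = f * T Z W X + T Z W Y.
Proof. by have [_ _ H _] := TP; exact: H. Qed.

Lemma form_swap12 X Y Z : T Y X Z = - T X Y Z.
Proof. exact: (three_form_swap12 (E := setT)). Qed.

Lemma form_swap23 X Y Z : T X Z Y = - T X Y Z.
Proof. exact: (three_form_swap23 (E := setT)). Qed.

(** Twice g(nabla_X Y, Z) for the Levi-Civita connection nabla. *)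
Definition koszul X Y Z : C :=
  (X (g Y Z) : C) + (Y (g X Z) : C) - (Z (g X Y) : C)
  + g (lie_bracket X Y) Z - g (lie_bracket X Z) Y - g (lie_bracket Y Z) X.

(** The connection is Levi-Civita plus T / 2. Skewness of T in the last two slots keeps it metric,
    skewness in the first two makes T its torsion; T = 0 gives the Levi-Civita connection itself. *)
Lemma connection_with_torsion : exists D : affine_connection M,
  [/\ forall X Y Z, g (D X Y) Z = Cinf_const M 2^-1 * (koszul X Y Z + T X Y Z),
      metric_connection g D &
      forall X Y Z, g (torsion D X Y) Z = T X Y Z].
Proof.
have /choice[N NP] : forall XY : V * V, exists W, forall Z,
    g W Z = Cinf_const M 2^-1 * (koszul XY.1 XY.2 Z + T XY.1 XY.2 Z).
  move=> [X Y] /=; apply: riesz => f Z W; rewrite form_linear3 /koszul.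
  rewrite !(lieDr, lieZr, metricDl, metricDr, metricZl, metricZr).
  rewrite !(derivD, derivM, vfieldD, vfieldZ).
  rewrite (metric_sym g Z Y) (metric_sym g Z X).
  by apply: CinfP => p; rewrite !(Cinf_half, CinfE); ring.
pose D X Y := N (X, Y).
have DE X Y Z : g (D X Y) Z = Cinf_const M 2^-1 * (koszul X Y Z + T X Y Z) := NP (X, Y) Z.
have D1 f X Y Z : D (f *: X + Y) Z = f *: D X Z + D Y Z.
  apply: (@metric_inj _ _ _ g) => W; rewrite metricDl metricZl !DE form_linear1 /koszul.
  rewrite !(lieDr, lieZr, lieDl, lieZl, metricDl, metricDr, metricNl).
  rewrite !(metricZl, metricZr, derivD, derivM, vfieldD, vfieldZ).
  by apply: CinfP => p; rewrite !(Cinf_half, CinfE); ring.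
have D2 X Y Z : D X (Y + Z) = D X Y + D X Z.
  apply: (@metric_inj _ _ _ g) => W; rewrite metricDl !DE.
  rewrite -[Y in LHS]scale1r form_linear2 /koszul scale1r.
  rewrite !(lieDr, lieZr, lieDl, lieZl, metricDl, metricDr, metricNl).
  rewrite !(metricZl, metricZr, derivD, derivM, vfieldD, vfieldZ).
  by apply: CinfP => p; rewrite !(Cinf_half, CinfE); ring.
have D3 X f Y : D X (f *: Y) = (X f : C) *: Y + f *: D X Y.
  apply: (@metric_inj _ _ _ g) => W; rewrite metricDl !metricZl !DE.
  have T0 : T X (f *: Y) W = f * T X Y W.
    have := form_linear2 f Y 0 X W; have := form_linear2 1 0 0 X W.
    by rewrite !addr0 scale1r mul1r => /addr_self_eq0 ->; rewrite addr0.
  rewrite T0 /koszul.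
  rewrite !(lieDr, lieZr, lieDl, lieZl, metricDl, metricDr, metricNl).
  rewrite !(metricZl, metricZr, derivD, derivM, vfieldD, vfieldZ).
  rewrite (metric_sym g Y X).
  by apply: CinfP => p; rewrite !(Cinf_half, CinfE); field.
exists (AffineConnection D1 D2 D3); split=> [X Y Z|X Y Z|X Y Z].
- exact: DE.
- rewrite -[RHS]/(g (D X Y) Z + g Y (D X Z)) (metric_sym g Y (D X Z)) !DE
    (form_swap23 X Y) /koszul (lie_anti Y Z) metricNl.
  rewrite (metric_sym g Z Y).
  by apply: CinfP => p; rewrite !(Cinf_half, CinfE); field.
- rewrite -[torsion _ X Y]/(D X Y - D Y X - lie_bracket X Y).
  rewrite !(metricDl, metricNl) !DE form_swap12 /koszul (lie_anti X Y) metricNl.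
  rewrite (metric_sym g Y X).
  by apply: CinfP => p; rewrite !(Cinf_half, CinfE); field.
Qed.

Lemma torsion_three_form (D : affine_connection M) :
  (forall X Y Z, g (torsion D X Y) Z = T X Y Z) -> skew_torsion g D.
Proof.
move=> DT; rewrite /skew_torsion.
suff -> : (fun X Y Z => g (torsion D X Y) Z) = T by [].
by apply/funext => X; apply/funext => Y; apply/funext => Z; exact: DT.
Qed.

End ThreeForms.

Lemma Cinf_half_double (a b : C) : b + b = a -> b = Cinf_const M 2^-1 * a.
Proof. by move=> <-; apply: CinfP => p; rewrite !(Cinf_half, CinfE); field. Qed.

Lemma three_form0 : three_form_on setT (fun _ _ _ : V => 0 : C).
Proof. by split=> *; rewrite ?mulr0 ?addr0. Qed.

(** Uniqueness counterpart of [connection_with_torsion], from the metric condition in its three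
    cyclic versions. *)
Lemma koszul_formula (D : affine_connection M) X Y Z :
  metric_connection g D -> skew_torsion g D ->
  g (D X Y) Z = Cinf_const M 2^-1 * (koszul X Y Z + g (torsion D X Y) Z).
Proof.
move=> mD sD; apply: Cinf_half_double.
have S1 := form_swap23 sD X Y Z; have S2 := form_swap12 sD Y Z X.
have S3 := form_swap23 sD Y X Z; have S4 := form_swap12 sD X Y Z.
have E1 := mD X Y Z; have E2 := mD Y X Z; have E3 := mD Z X Y.
rewrite /koszul E1 E2 E3.
move: S1 S2 S3 S4; rewrite /torsion !(metricDl, metricNl).
rewrite (metric_sym g Y (D X Z)) (metric_sym g X (D Y Z)) (metric_sym g X (D Z Y)).
rewrite (lie_anti X Y) (lie_anti Y Z) !metricNl.
move=> S1 S2 S3 S4; apply: CinfP => p.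
move: (congr1 (fun f : C => f p) S1) (congr1 (fun f : C => f p) S2)
  (congr1 (fun f : C => f p) S3) (congr1 (fun f : C => f p) S4).
rewrite !CinfE; lra.
Qed.

(** The Killing equation expands Y(g(X, Z)) into two bracket terms, which cancel g([X, Y], Z) and
    -g([Y, Z], X). For Y = xi_i the remainder is d eta_i(X, Z). *)
Lemma koszul_killing X Y Z : killing g Y ->
  koszul X Y Z = (X (g Y Z) : C) - Z (g X Y) - g (lie_bracket X Z) Y.
Proof.
move=> /(_ X Z) /eqP; rewrite /lie_metric -addrA -opprD subr_eq0 => /eqP.
rewrite /koszul => ->; rewrite (lie_anti Y X) metricNl (metric_sym g X).
ring.
Qed.

End Brackets.

(** * Almost 3-contact metric structures *)

Section AlmostContactMetric.
Context {R : realType} {m : nat} {M : smooth_manifold R m}.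
Local Notation C := (Cinf M).
Local Notation V := (vfield M).
Variables (g : riemannian_metric M) (s : almost_contact_metric g).
Implicit Types (X Y Z : V) (f : C).

Lemma Cinf_sqr_eq0 f : f * f = 0 -> f = 0.
Proof.
move=> H; apply: CinfP => p; have := congr1 (fun f : C => f p) H.
by rewrite CinfM Cinf0 => /eqP; rewrite mulf_eq0 orbb => /eqP.
Qed.

Lemma eta_linear f X : eta s (f *: X) = f * (eta s X : C).
Proof. by rewrite linearZ. Qed.

(** From phi^2 xi = 0, the formula for phi^2 at phi xi gives phi xi = a xi, whence a^2 = 0. The ring
    C^oo(M) has zero divisors but no nilpotents, so a = 0. *)
Lemma phi_xi : phi s (xi s) = 0.
Proof.
have p2 : phi s (phi s (xi s)) = 0 by rewrite phi_sq eta_xi scale1r addNr.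
set a : C := eta s (phi s (xi s)).
have e1 : phi s (xi s) = a *: xi s.
  have := phi_sq s (phi s (xi s)); rewrite p2 linear0 => /esym/eqP.
  by rewrite addrC subr_eq0 => /eqP.
suff a0 : a = 0 by rewrite e1 a0 scale0r.
apply: Cinf_sqr_eq0.
have : eta s (phi s (phi s (xi s))) = 0 by rewrite p2 linear0.
by rewrite e1 linearZ /= e1 !eta_linear eta_xi mulr1.
Qed.

(** Compare the two readings of phi^3 X, as phi(phi^2 X) and as phi^2(phi X). *)
Lemma eta_phi X : eta s (phi s X) = 0.
Proof.
have := congr1 (phi s) (phi_sq s X).
rewrite (phi_sq s (phi s X)) linearD linearN linearZ /= phi_xi scaler0 => /addrI.
by move=> /(congr1 (eta s)); rewrite eta_linear eta_xi mulr1 linear0.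
Qed.

Lemma eta_metric X : eta s X = g X (xi s).
Proof.
have := metric_phi s X (xi s); rewrite phi_xi metric0r eta_xi mulr1 => /esym/eqP.
by rewrite subr_eq0 => /eqP ->.
Qed.

Lemma phi_skew X Y : g (phi s X) Y = - g X (phi s Y).
Proof.
have := metric_phi s (phi s X) Y; rewrite eta_phi mul0r subr0 => <-.
rewrite phi_sq metricDl metricNl metricZl metric_sym.
by rewrite (metric_sym g (xi s)) -eta_metric eta_phi mulr0 addr0 metric_sym.
Qed.

End AlmostContactMetric.

Section EvenTriples.

Lemma I3_cases (i : 'I_3) : [\/ i = 0, i = 1 | i = 2].
Proof.
case: i => [[|[|[|n]]] i] //; [constructor 1|constructor 2|constructor 3];
  exact: val_inj.
Qed.

Lemma even_tripleP i j k : even_triple i j k <->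
  [\/ (i, j, k) = (0, 1, 2), (i, j, k) = (1, 2, 0) | (i, j, k) = (2, 0, 1)].
Proof.
split=> [[s es [-> -> ->]]|].
  have ne a b : a != b -> s a != s b by rewrite (inj_eq perm_inj).
  have [n01 n02 n12] := And3 (ne 0 1 isT) (ne 0 2 isT) (ne 1 2 isT).
  have odd_t a b : a != b -> s <> tperm a b.
    by move=> ab E; move: es; rewrite E odd_tperm ab.
  case: (I3_cases (s 0)) (I3_cases (s 1)) (I3_cases (s 2)) n01 n02 n12
    => E0 [] E1 [] E2; rewrite E0 E1 E2 ?eqxx // => _ _ _;
    try by [constructor 1|constructor 2|constructor 3].
  + by case: (odd_t 1 2 isT); apply/permP => x; case: (I3_cases x) => ->;
      rewrite permE /= ?E0 ?E1 ?E2.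
  + by case: (odd_t 0 1 isT); apply/permP => x; case: (I3_cases x) => ->;
      rewrite permE /= ?E0 ?E1 ?E2.
  + by case: (odd_t 0 2 isT); apply/permP => x; case: (I3_cases x) => ->;
      rewrite permE /= ?E0 ?E1 ?E2.
case=> -[-> -> ->].
- by exists 1%g; rewrite ?odd_perm1 ?perm1.
- by exists (tperm (0 : 'I_3)%R 1%R * tperm 0%R 2%R)%g;
    rewrite ?odd_permM ?odd_tperm // !permE /= !permE.
- by exists (tperm (0 : 'I_3)%R 2%R * tperm 0%R 1%R)%g;
    rewrite ?odd_permM ?odd_tperm // !permE /= !permE.
Qed.

Lemma levi_civita_even i j k : even_triple i j k -> levi_civita i j k = 1.
Proof.
move=> [s es [-> -> ->]]; rewrite /levi_civita (big_pred1 s) => [|t].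
  by rewrite (negbTE es).
apply/and3P/eqP => [[/eqP t0 /eqP t1 /eqP t2]|->]; last by split.
by apply/permP => x; case: (I3_cases x) => ->.
Qed.

End EvenTriples.

Section ThreeContactAlgebra.
Context {R : realType} {m : nat} {M : smooth_manifold R m}.
Local Notation C := (Cinf M).
Local Notation V := (vfield M).
Variables (g : riemannian_metric M) (S : 'I_3 -> almost_contact_metric g).
Hypothesis S3 : almost_3_contact S.
Implicit Types (X Y Z : V) (f : C) (i j k : 'I_3).

Lemma even_triple_rot i j k : even_triple i j k -> even_triple j k i.
Proof.
by move=> /even_tripleP[] [-> -> ->]; apply/even_tripleP;
  [constructor 2|constructor 3|constructor 1].
Qed.

Lemma even_triple_complete i j : i != j ->
  exists k, even_triple i j k \/ even_triple j i k.
Proof.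
case: (I3_cases i) => ->; case: (I3_cases j) => -> //= _;
  [exists 2; left|exists 1; right|exists 2; right|exists 0; left|exists 1; left
  |exists 0; right];
  apply/even_tripleP;
  by [constructor 1|constructor 2|constructor 3].
Qed.

Lemma sum_even_triple (U : nmodType) i j k (F : 'I_3 -> U) : even_triple i j k ->
  \sum_l F l = F i + F j + F k.
Proof.
have -> : \sum_l F l = F 0 + F 1 + F 2.
  rewrite !big_ord_recl big_ord0 addr0 addrA; congr (_ + _ + _); congr F; exact: val_inj.
move=> /even_tripleP[] [-> -> ->] //; last by rewrite addrC addrA.
by rewrite -addrA addrC.
Qed.

(** For i != j the field xi_i is, up to sign, in the image of phi_j, on which eta_j vanishes. *)
Lemma metric_xi i j : g (xi (S i)) (xi (S j)) = (i == j)%:R.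
Proof.
rewrite -eta_metric; have [->|ij] := eqVneq i j; first by rewrite eta_xi.
have [k [e|e]] := even_triple_complete ij.
  have [_ [h1 h2] [h3 h4]] := S3 (even_triple_rot e).
  by rewrite h1 eta_phi.
have [_ [h1 h2] [h3 h4]] := S3 (even_triple_rot (even_triple_rot e)).
by rewrite h2 linearN /= eta_phi oppr0.
Qed.

Lemma horizontal_phi i X : horizontal S X -> horizontal S (phi (S i) X).
Proof.
move=> hX j; have [->|ij] := eqVneq i j; first by rewrite eta_phi.
have [k [e|e]] := even_triple_complete ij.
  have [_ _ [_ h]] := S3 e; have := h X; rewrite hX => /esym/eqP.
  by rewrite oppr_eq0 => /eqP.
have [_ _ [h _]] := S3 e.
by have := h X; rewrite hX.
Qed.

Definition vert X : V := \sum_i (eta (S i) X : C) *: xi (S i).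
Definition hor X : V := X - vert X.

Lemma eta_vert i X : eta (S i) (vert X) = eta (S i) X.
Proof.
rewrite eta_metric metric_suml (bigD1 i) //= big1 => [|j ji].
  by rewrite addr0 metricZl metric_xi eqxx mulr1.
by rewrite metricZl metric_xi (negbTE ji) mulr0.
Qed.

Lemma horizontal_hor X : horizontal S (hor X).
Proof. by move=> i; rewrite /hor linearB /= eta_vert subrr. Qed.

Lemma hor_id X : horizontal S X -> hor X = X.
Proof. by move=> hX; rewrite /hor /vert big1 ?subr0 // => i _; rewrite hX scale0r. Qed.

Lemma hor_xi i : hor (xi (S i)) = 0.
Proof.
rewrite /hor /vert (bigD1 i) //= big1 => [|j ji].
  by rewrite eta_xi scale1r addr0 subrr.
by rewrite eta_metric metric_xi eq_sym (negbTE ji) scale0r.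
Qed.

Lemma hor_linear f X Y : hor (f *: X + Y) = f *: hor X + hor Y.
Proof.
have E : vert (f *: X + Y) = f *: vert X + vert Y.
  rewrite /vert scaler_sumr -big_split; apply: eq_bigr => i _ /=.
  by rewrite linearD /= linearZ /= scalerDl scalerA.
by rewrite /hor E scalerBr opprD addrACA.
Qed.

Lemma hor_vert X : X = hor X + vert X.
Proof. by rewrite subrK. Qed.

Lemma metric_split X Y : g X Y = g X (hor Y) + g X (vert Y).
Proof. by rewrite -metricDr -hor_vert. Qed.

Lemma vertical_vert X : vertical S (vert X).
Proof. by exists (fun i => eta (S i) X). Qed.

Lemma metric_horizontal_xi X i : horizontal S X -> g X (xi (S i)) = 0.
Proof. by move=> hX; rewrite -eta_metric hX. Qed.

Lemma metric_horizontal_vertical X Y : horizontal S X -> vertical S Y -> g X Y = 0.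
Proof.
move=> hX [f ->]; rewrite metric_sumr big1 // => i _.
by rewrite metricZr metric_horizontal_xi ?mulr0.
Qed.

Lemma vertical_xi i : vertical S (xi (S i)).
Proof.
exists (fun j => (j == i)%:R); rewrite (bigD1 i) //= big1 => [|j /negbTE->].
  by rewrite eqxx scale1r addr0.
by rewrite scale0r.
Qed.

Lemma vertical_orth X : (forall Y, horizontal S Y -> g X Y = 0) -> vertical S X.
Proof.
move=> H; suff -> : X = vert X by exact: vertical_vert.
apply: (@metric_inj _ _ _ g) => Z; rewrite (metric_split X Z) (metric_split _ Z).
rewrite (H _ (@horizontal_hor Z)) [g (vert X) _]metric_sym.
rewrite (metric_horizontal_vertical (@horizontal_hor Z) (vertical_vert X)) !add0r.
rewrite /vert !metric_sumr; apply: eq_bigr => i _.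
by rewrite !metricZr -!eta_metric eta_vert.
Qed.

Lemma metric_eq_hor X Y : horizontal S X -> horizontal S Y ->
  (forall Z, horizontal S Z -> g X Z = g Y Z) -> X = Y.
Proof.
move=> hX hY H; apply: (@metric_inj _ _ _ g) => Z.
rewrite (metric_split X Z) (metric_split Y Z) (H _ (@horizontal_hor Z)).
rewrite (metric_horizontal_vertical hX (vertical_vert Z)).
by rewrite (metric_horizontal_vertical hY (vertical_vert Z)).
Qed.

Lemma vertical_id X : vertical S X -> vert X = X.
Proof.
move=> [f ->]; apply: eq_bigr => i _; congr (_ *: _).
rewrite linear_sum (bigD1 i) //= big1 => [|j ji].
  by rewrite addr0 eta_linear eta_xi mulr1.
by rewrite eta_linear eta_metric metric_xi (negbTE ji) mulr0.
Qed.

Lemma ext_diff_linear i f X Y Z :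
  ext_diff (eta (S i)) (f *: X + Y) Z =
  f * ext_diff (eta (S i)) X Z + ext_diff (eta (S i)) Y Z.
Proof.
rewrite /ext_diff !eta_metric.
rewrite !(lieDl, lieZl, metricDl, metricNl, metricZl, derivD, derivM, vfieldD, vfieldZ).
ring.
Qed.

Lemma ext_diff_swap i X Y : ext_diff (eta (S i)) Y X = - ext_diff (eta (S i)) X Y.
Proof.
rewrite /ext_diff (lie_anti X Y) linearN /=.
ring.
Qed.

Hypothesis xiK : forall i, killing g (xi (S i)).

Lemma deriv_metric_xi X i j : X (g (xi (S i)) (xi (S j))) = 0 :> C.
Proof.
have X1 : X 1 = 0 :> C.
  by apply: (@addr_self_eq0 C); have := derivM X 1 1; rewrite !mulr1 mul1r.
by rewrite metric_xi; case: (i == j); rewrite ?deriv0.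
Qed.

Lemma koszul_xi X i Y : koszul g X (xi (S i)) Y = ext_diff (eta (S i)) X Y.
Proof. by rewrite koszul_killing // /ext_diff !eta_metric (metric_sym g (xi _)). Qed.

(** The Killing equation of xi_j at (Y, xi_i) moves the bracket from Y to xi_i. The right side is
    skew in i and j, which makes the torsion prescriptions for different Reeb fields compatible. *)
Lemma ext_diff_xi i j Y : horizontal S Y ->
  ext_diff (eta (S i)) (xi (S j)) Y = g (lie_bracket (xi (S j)) (xi (S i))) Y.
Proof.
move=> hY; rewrite /ext_diff hY !eta_metric deriv_metric_xi.
have := @xiK j Y (xi (S i)); rewrite /lie_metric metric_horizontal_xi //.
by rewrite deriv0 subr0 sub0r (metric_sym g Y) => /eqP; rewrite subr_eq0 => /eqP.
Qed.

End ThreeContactAlgebra.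

(** * Existence of compatible connections *)

Section ThreeFormConstructions.
Context {R : realType} {m : nat} {M : smooth_manifold R m}.
Local Notation C := (Cinf M).
Local Notation V := (vfield M).
Implicit Types (X Y Z : V) (f : C) (E : set V) (t : V -> V -> V -> C).

Lemma Cinf_eq_opp (f : C) : f = - f -> f = 0.
Proof.
move=> H; apply: CinfP => p; have := congr1 (fun f : C => f p) H.
rewrite CinfN Cinf0; lra.
Qed.

Lemma three_formD E t t' : three_form_on E t -> three_form_on E t' ->
  three_form_on E (fun X Y Z => t X Y Z + t' X Y Z).
Proof.
move=> [t1 t2 t3 t4] [u1 u2 u3 u4]; split.
- by move=> f X Y Z W eX eY eZ eW; rewrite t1 // u1 // mulrDr addrACA.
- by move=> f X Y Z W eX eY eZ eW; rewrite t2 // u2 // mulrDr addrACA.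
- by move=> f X Y Z W eX eY eZ eW; rewrite t3 // u3 // mulrDr addrACA.
- move=> X Y eX eY; have [-> -> ->] := t4 X Y eX eY.
  by have [-> -> ->] := u4 X Y eX eY; rewrite !addr0.
Qed.

Lemma three_formZ E a t : three_form_on E t ->
  three_form_on E (fun X Y Z => a * t X Y Z).
Proof.
move=> [t1 t2 t3 t4]; split.
- by move=> f X Y Z W eX eY eZ eW; rewrite t1 // mulrDr mulrCA.
- by move=> f X Y Z W eX eY eZ eW; rewrite t2 // mulrDr mulrCA.
- by move=> f X Y Z W eX eY eZ eW; rewrite t3 // mulrDr mulrCA.
- by move=> X Y eX eY; have [-> -> ->] := t4 X Y eX eY; rewrite !mulr0.
Qed.

Lemma three_formN E t : three_form_on E t ->
  three_form_on E (fun X Y Z => - t X Y Z).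
Proof.
move=> /(three_formZ (-1)); congr three_form_on.
by apply/funext => X; apply/funext => Y; apply/funext => Z; rewrite mulN1r.
Qed.

Lemma three_form_sub E t : three_form_on setT t -> three_form_on E t.
Proof.
by move=> [t1 t2 t3 t4]; split=> *; [exact: t1|exact: t2|exact: t3|exact: t4].
Qed.

(** A transposition of the arguments permutes the three cyclic terms with a sign, so skewness of t
    in two slots suffices. It serves both [F] and the vertical part of the torsion. *)
Lemma three_form_cyclic t :
  (forall f X Y Z W, t (f *: X + Y) Z W = f * t X Z W + t Y Z W) ->
  (forall f X Y Z W, t Z W (f *: X + Y) = f * t Z W X + t Z W Y) ->
  (forall X Y Z, t Y X Z = - t X Y Z) ->
  three_form_on setT (fun X Y Z => t X Y Z + t Y Z X + t Z X Y).
Proof.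
move=> t1 t3 tN.
have t2 f X Y Z W : t Z (f *: X + Y) W = f * t Z X W + t Z Y W.
  by rewrite tN t1 (tN Z X) (tN Z Y) opprD mulrN !opprK.
have t0 X Y : t X X Y = 0 by apply: Cinf_eq_opp; exact: tN.
split=> [f X Y Z W _ _ _ _|f X Y Z W _ _ _ _|f X Y Z W _ _ _ _|X Y _ _].
- by rewrite t1 t2 t3; apply: CinfP => p; rewrite !CinfE; ring.
- by rewrite t1 t2 t3; apply: CinfP => p; rewrite !CinfE; ring.
- by rewrite t1 t2 t3; apply: CinfP => p; rewrite !CinfE; ring.
- by rewrite !t0 (tN X Y); split; apply: CinfP => p; rewrite !CinfE; ring.
Qed.

End ThreeFormConstructions.

Section Existence.
Context {R : realType} {m : nat} {M : smooth_manifold R m}.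
Local Notation C := (Cinf M).
Local Notation V := (vfield M).
Variables (g : riemannian_metric M) (S : 'I_3 -> almost_contact_metric g).
Variable s : almost_contact_metric g.
Hypothesis S3 : almost_3_contact S.
Hypothesis sS : associated_sphere S s.
Implicit Types (X Y Z : V) (f : C) (i j k : 'I_3).
Local Notation hor := (hor S).
Local Notation half := (Cinf_const M 2^-1).

Lemma horizontal_eta X : horizontal S X -> eta s X = 0.
Proof.
move=> hX; have [a [_ _ _ ->]] := sS.
by rewrite big1 // => i _; rewrite hX mulr0.
Qed.

Lemma horizontal_linear f X Y : horizontal S X -> horizontal S Y ->
  horizontal S (f *: X + Y).
Proof. by move=> hX hY i; rewrite linearD linearZ /= hX hY scaler0 addr0. Qed.

Lemma horizontal_phi_sphere X : horizontal S X -> horizontal S (phi s X).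
Proof.
move=> hX i; have [a [_ -> _ _]] := sS; rewrite linear_sum big1 // => j _.
have H : eta (S i) (phi (S j) X) = 0 by exact: (horizontal_phi S3).
by rewrite linearZ /= H scaler0.
Qed.

Lemma phi_phi_horizontal X : horizontal S X -> phi s (phi s X) = - X.
Proof. by move=> hX; rewrite phi_sq horizontal_eta // scale0r addr0. Qed.

Lemma three_form_hor t : three_form_on (horizontal S) t ->
  three_form_on setT (fun X Y Z => t (hor X) (hor Y) (hor Z)).
Proof.
move=> [t1 t2 t3 t4].
have hh := horizontal_hor S3.
split=> [f X Y Z W _ _ _ _|f X Y Z W _ _ _ _|f X Y Z W _ _ _ _|X Y _ _];
  rewrite ?hor_linear.
- exact: t1.
- exact: t2.
- exact: t3.
- exact: t4.
Qed.

Section LeviCivita.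
Variable L : affine_connection M.
Hypothesis Lmetric : metric_connection g L.
Hypothesis Ltorsion : forall X Y, lie_bracket X Y = L X Y - L Y X.

(* g((nabla_X phi) Y, Z), since phi is skew-symmetric. *)
Let A X Y Z : C := g (L X (phi s Y)) Z + g (L X Y) (phi s Z).

Let A_linear1 f X Y Z W : A (f *: X + Y) Z W = f * A X Z W + A Y Z W.
Proof. by rewrite /A !nabla_linear !metricDl !metricZl mulrDr addrACA. Qed.

Let A_skew X Y Z : A X Z Y = - A X Y Z.
Proof.
have E1 := Lmetric X (phi s Y) Z; have E2 := Lmetric X Y (phi s Z).
have : A X Y Z + A X Z Y = 0.
  transitivity ((X (g (phi s Y) Z) : C) + X (g Y (phi s Z))).
    rewrite E1 E2 /A (metric_sym g (L X (phi s Z))) (metric_sym g (L X Z)).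
    ring.
  by rewrite -derivD phi_skew addNr deriv0.
by move/eqP; rewrite addr_eq0 => /eqP ->; rewrite opprK.
Qed.

Let A_linear3 f X Y Z W : A Z W (f *: X + Y) = f * A Z W X + A Z W Y.
Proof.
rewrite /A linearD linearZ /= !metricDr !metricZr mulrDr.
by rewrite addrACA.
Qed.

Let A_linear2 f X Y Z W : A Z (f *: X + Y) W = f * A Z X W + A Z Y W.
Proof. by rewrite A_skew A_linear3 (A_skew Z X) (A_skew Z Y) opprD mulrN !opprK. Qed.

Let A_N1 X Y Z : A (- X) Y Z = - A X Y Z.
Proof.
have A0 : A 0 Y Z = 0.
  by have := A_linear1 1 0 0 Y Z; rewrite scaler0 addr0 mul1r => /addr_self_eq0.
by rewrite -[- X]addr0 -scaleN1r A_linear1 A0 addr0 mulN1r.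
Qed.

(** Derivative of phi^2 = -1 on H: up to vertical terms, nabla_X phi anticommutes with phi, and phi
    is skew for g. *)
Let A_phi X Y Z : horizontal S Y -> horizontal S Z ->
  A X (phi s Y) Z = A X Y (phi s Z).
Proof.
move=> hY hZ; rewrite /A !phi_phi_horizontal // metricNr.
have -> : L X (- Y) = - L X Y.
  have := nabla_additive L X Y (- Y); have := nabla_additive L X 0 0.
  rewrite !addr0 subrr => /addr_self_eq0 -> /esym/eqP.
  by rewrite addrC addr_eq0 => /eqP.
by rewrite metricNl addrC.
Qed.

Let A_N3 X Y Z : A X Y (- Z) = - A X Y Z.
Proof.
have A0 : A X Y 0 = 0.
  by have := A_linear3 1 0 0 X Y; rewrite scaler0 addr0 mul1r => /addr_self_eq0.
by rewrite -[- Z]addr0 -scaleN1r A_linear3 A0 addr0 mulN1r.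
Qed.

Let A_phi_phi X Y Z : horizontal S Y -> horizontal S Z ->
  A X (phi s Y) (phi s Z) = - A X Y Z.
Proof.
move=> hY hZ; rewrite A_phi //; last exact: horizontal_phi_sphere.
by rewrite phi_phi_horizontal // A_N3.
Qed.

Let N X Y Z : C := g (nijenhuis s X Y) Z.

(** Since [L] is torsion-free, brackets become differences of covariant derivatives. Pairing with a
    horizontal Z removes the xi term and turns phi^2 [X, Y] into -[X, Y]; what remains groups into
    derivatives of phi. *)
Let NE X Y Z : horizontal S X -> horizontal S Y -> horizontal S Z ->
  N X Y Z = A (phi s X) Y Z - A (phi s Y) X Z - A Y X (phi s Z) + A X Y (phi s Z).
Proof.
move=> hX hY hZ; rewrite /N /nijenhuis.
have e0 : g (xi s) Z = 0 by rewrite metric_sym -eta_metric horizontal_eta.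
rewrite !(metricDl, metricNl, metricZl) e0 mulr0 addr0 !phi_skew.
rewrite phi_phi_horizontal // metricNr /A phi_phi_horizontal // !metricNr.
rewrite !Ltorsion !(metricDl, metricNl).
ring.
Qed.

Let F X Y Z : C := A (phi s Z) X Y + A (phi s X) Y Z + A (phi s Y) Z X.

Let F_form : three_form_on setT F.
Proof.
apply: (three_form_cyclic (t := fun X Y Z => A (phi s Z) X Y)).
- by move=> f X Y Z W; rewrite A_linear2.
- by move=> f X Y Z W; rewrite linearD linearZ /= A_linear1.
- by move=> X Y Z; rewrite A_skew.
Qed.

(* For horizontal arguments F is d Phi(phi X, phi Y, phi Z), Phi = g(., phi .). *)
Definition horizontal_torsion X Y Z : C := N X Y Z - F X Y Z.

Hypothesis Nskew : skew_nijenhuis_on_horizontal S s.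

Lemma horizontal_torsion_form : three_form_on (horizontal S) horizontal_torsion.
Proof. exact: (three_formD Nskew (three_formN (three_form_sub _ F_form))). Qed.

Let N_swap23 X Y Z : horizontal S X -> horizontal S Y -> horizontal S Z ->
  N X Z Y = - N X Y Z.
Proof. by apply: (three_form_swap23 _ Nskew) => U W; exact: horizontal_linear. Qed.

Let N_swap12 X Y Z : horizontal S X -> horizontal S Y -> horizontal S Z ->
  N Y X Z = - N X Y Z.
Proof. by apply: (three_form_swap12 _ Nskew) => U W; exact: horizontal_linear. Qed.

(* With a_1 = A(phi X, phi Y, Z), b_1 = A(X, Y, Z) and their cyclic permutations,
   N(X, Y, phi Z) = N(X, phi Y, Z) = (a_1 - b_1) + (a_2 - b_2). The total
   skew-symmetry of N makes the three differences equal, which is what the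
   identity needs. *)
Lemma horizontal_torsion_phi X Y Z :
  horizontal S X -> horizontal S Y -> horizontal S Z ->
  A X Y Z + half *
    (horizontal_torsion X (phi s Y) Z + horizontal_torsion X Y (phi s Z)) = 0.
Proof.
move=> hX hY hZ.
have hp := horizontal_phi_sphere.
have NB X' Y' Z' : horizontal S X' -> horizontal S Y' -> horizontal S Z' ->
    N X' Y' (phi s Z') = A (phi s X') (phi s Y') Z' + A (phi s Y') (phi s Z') X'
      - A X' Y' Z' - A Y' Z' X' /\
    N X' (phi s Y') Z' = N X' Y' (phi s Z').
  move=> hX' hY' hZ'.
  rewrite (NE hX' hY' (hp _ hZ')) (NE hX' (hp _ hY') hZ').
  rewrite (phi_phi_horizontal hY') (phi_phi_horizontal hZ') A_N1 !A_N3.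
  rewrite -(A_phi (phi s X') hY' hZ') (A_skew (phi s Y') (phi s Z') X').
  rewrite (A_skew Y' Z' X') (A_phi_phi X' hY' hZ').
  by split; apply: CinfP => p; rewrite !CinfE; ring.
have [B1 C1] := NB X Y Z hX hY hZ; have [B2 C2] := NB Y Z X hY hZ hX.
have [B3 C3] := NB Z X Y hZ hX hY.
(* Total skewness rotates N(X, Y, phi Z) to N(Y, phi Z, X), and [C2] moves phi from the second slot
   to the third. *)
have E1 : N X Y (phi s Z) = N Y Z (phi s X).
  rewrite -C2 (N_swap12 hY hX (hp _ hZ)) (N_swap23 hY (hp _ hZ) hX).
  by rewrite opprK.
have E2 : N Y Z (phi s X) = N Z X (phi s Y).
  rewrite -C3 (N_swap12 hZ hY (hp _ hX)) (N_swap23 hZ (hp _ hX) hY).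
  by rewrite opprK.
rewrite /horizontal_torsion C1 /F (phi_phi_horizontal hY) (phi_phi_horizontal hZ) !A_N1.
rewrite -(A_phi (phi s X) hY hZ).
move: E1 E2; rewrite B1 B2 B3 (A_phi (phi s Z) hX hY) => E1 E2.
apply: CinfP => p.
move: (congr1 (fun f : C => f p) E1) (congr1 (fun f : C => f p) E2).
rewrite !(Cinf_half, CinfE); lra.
Qed.

Hypothesis xiK : forall i, killing g (xi (S i)).
Hypothesis LE : forall X Y Z, g (L X Y) Z = half * koszul g X Y Z.

Let dE i X Y : C := ext_diff (eta (S i)) X Y.

Let beta X Y Z : C :=
  \sum_i (eta (S i) Z : C) * (dE i X Y + dE i (hor X) (hor Y)).

(* The terms d eta_i(X, Y) and d eta_i(hor X, hor Y) are averaged because the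
   cyclic sum counts the components with two vertical arguments twice. *)
Definition full_torsion X Y Z : C :=
  horizontal_torsion (hor X) (hor Y) (hor Z)
  + half * (beta X Y Z + beta Y Z X + beta Z X Y).

Lemma full_torsion_form : three_form_on setT full_torsion.
Proof.
apply: (three_formD (three_form_hor horizontal_torsion_form)).
apply: three_formZ; apply: three_form_cyclic.
- move=> f X Y Z W; rewrite /beta mulr_sumr -big_split; apply: eq_bigr => i _ /=.
  rewrite /dE hor_linear !ext_diff_linear.
  move: (ext_diff _ X _) (ext_diff _ Y _) (ext_diff _ (hor X) _) (ext_diff _ (hor Y) _).
  move: (eta _ W : C) => e a b c d.
  ring.
- move=> f X Y Z W; rewrite /beta mulr_sumr -big_split; apply: eq_bigr => i _ /=.
  by rewrite linearD linearZ /= mulrDl mulrA.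
- move=> X Y Z; rewrite /beta -sumrN; apply: eq_bigr => i _.
  by rewrite /dE (ext_diff_swap S i X Y) (ext_diff_swap S i (hor X)) -opprD mulrN.
Qed.

Let beta_horizontal X Y Z : horizontal S Z -> beta X Y Z = 0.
Proof. by move=> hZ; rewrite /beta big1 // => i _; rewrite hZ mul0r. Qed.

Lemma full_torsion_horizontal X Y Z :
  horizontal S X -> horizontal S Y -> horizontal S Z ->
  full_torsion X Y Z = horizontal_torsion X Y Z.
Proof.
move=> hX hY hZ; rewrite /full_torsion !hor_id // !beta_horizontal //.
by rewrite !addr0 mulr0 addr0.
Qed.

Let dE_sum i (I : Type) (r : seq I) (a : I -> C) (X : I -> V) Y :
  dE i (\sum_(l <- r) a l *: X l) Y = \sum_(l <- r) a l * dE i (X l) Y.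
Proof.
elim: r => [|l r IH]; last by rewrite !big_cons /dE ext_diff_linear -IH.
have := ext_diff_linear S i 1 0 0 Y.
by rewrite !big_nil scaler0 addr0 mul1r => /addr_self_eq0.
Qed.

Lemma full_torsion_xi i X Y : horizontal S Y ->
  full_torsion X Y (xi (S i)) = ext_diff (eta (S i)) X Y.
Proof.
move=> hY; rewrite /full_torsion hor_xi //.
have h0 : horizontal S 0 by move=> l; rewrite linear0.
have -> : horizontal_torsion (hor X) (hor Y) 0 = 0.
  have [_ _ t3 _] := horizontal_torsion_form.
  have hh := horizontal_hor S3.
  have := t3 1 0 0 (hor X) (hor Y) h0 h0 (@hh X) (@hh Y).
  by rewrite scaler0 addr0 mul1r => /addr_self_eq0.
have -> : beta (xi (S i)) X Y = 0 by exact: beta_horizontal.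
rewrite addr0 add0r.
have -> : beta X Y (xi (S i)) = dE i X Y + dE i (hor X) Y.
  rewrite /beta (bigD1 i) //= big1 => [|l li].
    by rewrite eta_xi mul1r addr0 (hor_id hY).
  by rewrite eta_metric (metric_xi S3) eq_sym (negbTE li) mul0r.
(* By [ext_diff_xi], d eta_l(Y, xi_i) = g([xi_l, xi_i], Y) = d eta_i(xi_l, Y), so the sum over l
   assembles the vertical part of X. Together with d eta_i(hor X, Y) it makes the second copy of d
   eta_i(X, Y) that the factor one half calls for. *)
have -> : beta Y (xi (S i)) X = dE i (vert S X) Y.
  rewrite /vert dE_sum /beta; apply: eq_bigr => l _; congr (_ * _).
  have -> : dE l (hor Y) (hor (xi (S i))) = 0.
    rewrite hor_xi // /dE (ext_diff_swap S).
    have := dE_sum l [::] (fun _ : unit => 0) (fun=> 0) (hor Y).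
    by rewrite !big_nil /dE => ->; rewrite oppr0.
  rewrite addr0 /dE (ext_diff_swap S) !(ext_diff_xi S3 xiK) //.
  by rewrite lie_anti metricNl opprK.
have E : dE i (hor X) Y + dE i (vert S X) Y = dE i X Y.
  have := ext_diff_linear S i 1 (hor X) (vert S X) Y.
  by rewrite scale1r mul1r -hor_vert.
by rewrite -addrA E -(Cinf_half_double erefl).
Qed.

Lemma compatible_with_full_torsion (D : affine_connection M) :
  (forall X Y Z, g (D X Y) Z = half * (koszul g X Y Z + full_torsion X Y Z)) ->
  metric_connection g D -> skew_torsion g D ->
  compatible_connection S s D.
Proof.
move=> DE mD sD.
have DL X Y Z : g (D X Y) Z = g (L X Y) Z + half * full_torsion X Y Z.
  by rewrite DE LE mulrDr.
have Dhor X Y : horizontal S Y -> horizontal S (D X Y).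
  move=> hY i; rewrite eta_metric DL full_torsion_xi //.
  (* Since g(Y, xi_i) = 0, g(L_X Y, xi_i) = -g(Y, L_X xi_i) = -d eta_i(X, Y) / 2, which half of the
     torsion cancels. *)
  have e1 := Lmetric X Y (xi (S i)); rewrite metric_horizontal_xi // deriv0 in e1.
  have e2 := LE X (xi (S i)) Y; rewrite koszul_killing // in e2.
  move: e1; rewrite (metric_sym g Y) e2 -!eta_metric.
  rewrite (metric_sym g (xi (S i))) -eta_metric.
  rewrite /ext_diff => e1; apply: CinfP => p; move: (congr1 (fun f : C => f p) e1).
  rewrite !(Cinf_half, CinfE); lra.
split=> //; first split=> // X Y vY.
  apply: (vertical_orth S3) => Z hZ.
  have := mD X Y Z.
  rewrite metric_sym (metric_horizontal_vertical hZ vY) deriv0.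
  rewrite (metric_sym g Y) (metric_horizontal_vertical (Dhor X Z hZ) vY) addr0.
  by move=> <-.
move=> X Y hX hY; rewrite /nabla_endo.
have hp := horizontal_phi_sphere.
apply/eqP; rewrite subr_eq0; apply/eqP.
apply: (metric_eq_hor S3).
- by apply: Dhor; exact: hp.
- by apply: hp; exact: Dhor.
(* For D = L + T / 2, g((D_X phi) Y, Z) is A(X, Y, Z) plus half of T(X, phi Y, Z) + T(X, Y, phi Z),
   the expression treated in [horizontal_torsion_phi]. *)
move=> Z hZ; rewrite phi_skew !DL.
rewrite !full_torsion_horizontal //; try exact: hp.
have := horizontal_torsion_phi hX hY hZ; rewrite /A => E.
apply: CinfP => p; move: (congr1 (fun f : C => f p) E).
rewrite !(Cinf_half, CinfE); lra.
Qed.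

End LeviCivita.

Lemma compatible_connection_exists :
  skew_nijenhuis_on_horizontal S s -> (forall i, killing g (xi (S i))) ->
  exists D : affine_connection M, compatible_connection S s D.
Proof.
move=> Ns xiK.
have [L [LE Lm Lt]] := connection_with_torsion g (@three_form0 R m M).
have Lt' X Y : lie_bracket X Y = L X Y - L Y X.
  apply/esym/eqP; rewrite -subr_eq0; apply/eqP.
  by apply: (metric_nondegenerate (g := g)) => Z; exact: Lt.
have LE' X Y Z : g (L X Y) Z = half * koszul g X Y Z by rewrite LE addr0.
have TP := full_torsion_form Lm Ns.
have [D [DE Dm Dt]] := connection_with_torsion g TP.
exists D; apply: (compatible_with_full_torsion Lm Lt' Ns xiK LE' DE Dm).
exact: (torsion_three_form TP Dt).
Qed.

End Existence.

(** * Covariant derivatives of compatible connections *)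

Section CompatibleConnections.
Context {R : realType} {m : nat} {M : smooth_manifold R m}.
Local Notation C := (Cinf M).
Local Notation V := (vfield M).
Variables (g : riemannian_metric M) (S : 'I_3 -> almost_contact_metric g).
Variable s : almost_contact_metric g.
Hypothesis S3 : almost_3_contact S.
Hypothesis xiK : forall i, killing g (xi (S i)).
Variable D : affine_connection M.
Hypothesis Dcomp : compatible_connection S s D.
Implicit Types (X Y Z : V) (f : C) (i j k : 'I_3).
Local Notation half := (Cinf_const M 2^-1).

Let T X Y Z : C := g (torsion D X Y) Z.

Let Dmetric : metric_connection g D. Proof. by case: Dcomp. Qed.
Let Tform : three_form_on setT T. Proof. by case: Dcomp. Qed.
Let Dhor X Y : horizontal S Y -> horizontal S (D X Y).
Proof. by case: Dcomp => _ _ [h _] _; exact: h. Qed.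
Let Dvert X Y : vertical S Y -> vertical S (D X Y).
Proof. by case: Dcomp => _ _ [_ h] _; exact: h. Qed.

Let T_cyc X Y Z : T X Y Z = T Y Z X.
Proof. by rewrite (form_swap23 Tform Y X) (form_swap12 Tform X Y) opprK. Qed.

Lemma metric_nabla_xi X i Y :
  g (D X (xi (S i))) Y = half * (ext_diff (eta (S i)) X Y + T X (xi (S i)) Y).
Proof. by rewrite (koszul_formula _ _ _ Dmetric Tform) koszul_xi. Qed.

Lemma metric_nabla_xi_horizontal X i Y : horizontal S Y ->
  g (D X (xi (S i))) Y = 0.
Proof.
move=> hY; rewrite metric_sym; apply: metric_horizontal_vertical => //.
exact/Dvert/vertical_xi.
Qed.

Lemma torsion_xi_xi i j Y : horizontal S Y ->
  T (xi (S i)) (xi (S j)) Y = - g (lie_bracket (xi (S i)) (xi (S j))) Y.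
Proof.
move=> hY; rewrite /T /torsion !(metricDl, metricNl).
by rewrite !metric_nabla_xi_horizontal // subrr sub0r.
Qed.

(** Rotating xi_i to the last slot leaves only -eta_i([X, Y]), because D_X Y and D_Y X are
    horizontal. *)
Lemma torsion_xi i X Y : horizontal S X -> horizontal S Y ->
  T (xi (S i)) X Y = ext_diff (eta (S i)) X Y.
Proof.
move=> hX hY; rewrite T_cyc /T /torsion !(metricDl, metricNl) -!eta_metric.
have -> : eta (S i) (D X Y) = 0 by exact: Dhor.
have -> : eta (S i) (D Y X) = 0 by exact: Dhor.
by rewrite /ext_diff hX hY !deriv0 subrr.
Qed.

(** Both d eta_i(X, xi_j) and the torsion term are g([xi_i, xi_j], X) up to sign, and the signs are
    opposite. Hence D_X xi_i depends only on the vertical part of X. *)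
Lemma metric_nabla_horizontal_xi X i j : horizontal S X ->
  g (D X (xi (S i))) (xi (S j)) = 0.
Proof.
move=> hX; rewrite metric_nabla_xi T_cyc torsion_xi_xi //.
rewrite ext_diff_swap (ext_diff_xi S3 xiK) // (lie_anti (xi (S i))) metricNl opprK.
by rewrite subrr mulr0.
Qed.

Lemma metric_nabla_xi_sum X i j : g (D X (xi (S i))) (xi (S j)) =
  \sum_l (eta (S l) X : C) * g (D (xi (S l)) (xi (S i))) (xi (S j)).
Proof.
have lin f Y Z : g (D (f *: Y + Z) (xi (S i))) (xi (S j)) =
    f * g (D Y (xi (S i))) (xi (S j)) + g (D Z (xi (S i))) (xi (S j)).
  by rewrite nabla_linear metricDl metricZl.
have lin0 : g (D 0 (xi (S i))) (xi (S j)) = 0.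
  by have := lin 1 0 0; rewrite scaler0 addr0 mul1r => /addr_self_eq0.
have lin_sum (r : seq 'I_3) :
    g (D (\sum_(l <- r) (eta (S l) X : C) *: xi (S l)) (xi (S i))) (xi (S j)) =
    \sum_(l <- r) (eta (S l) X : C) * g (D (xi (S l)) (xi (S i))) (xi (S j)).
  by elim: r => [|l r IH]; rewrite ?big_nil // !big_cons lin IH.
have E : X = 1 *: vert S X + hor S X by rewrite scale1r addrC -hor_vert.
have hX : horizontal S (hor S X) by exact: (@horizontal_hor _ _ _ _ _ S3 X).
rewrite {1}E lin mul1r (metric_nabla_horizontal_xi i j hX) addr0.
exact: lin_sum.
Qed.

Lemma metric_nabla_xi_xi l i j :
  g (D (xi (S l)) (xi (S i))) (xi (S j)) =
  half * (eta (S i) (lie_bracket (xi (S j)) (xi (S l)))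
    + T (xi (S l)) (xi (S i)) (xi (S j))).
Proof.
rewrite metric_nabla_xi /ext_diff !eta_metric !deriv_metric_xi // subrr sub0r.
by rewrite (lie_anti (xi (S l))) metricNl.
Qed.

Lemma eta_lie_xi i j : eta (S i) (lie_bracket (xi (S i)) (xi (S j))) = 0.
Proof.
have := @xiK i (xi (S j)) (xi (S i)).
rewrite /lie_metric deriv_metric_xi // sub0r eta_metric.
by rewrite lie_self metric0r subr0 => /eqP; rewrite oppr_eq0 => /eqP.
Qed.

Lemma torsion_even i j k : even_triple i j k ->
  T (xi (S i)) (xi (S j)) (xi (S k)) = parameter_function S D.
Proof.
by move=> /even_tripleP[] [-> -> ->] //; rewrite T_cyc // T_cyc.
Qed.

Variable delta : C.
Hypothesis Hdelta : reeb_commutator S delta.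

Lemma nabla_xi X i j k : even_triple i j k ->
  D X (xi (S i)) = (half * (delta *+ 2 + parameter_function S D)) *:
    ((eta (S k) X : C) *: xi (S j) - (eta (S j) X : C) *: xi (S k)).
Proof.
move=> e; have e1 := even_triple_rot e; have e2 := even_triple_rot e1.
set lam := half * _.
have br i' j' k' : even_triple i' j' k' ->
    eta (S k') (lie_bracket (xi (S i')) (xi (S j'))) = delta *+ 2.
  by move=> e'; rewrite Hdelta levi_civita_even.
have brN i' j' k' : even_triple i' j' k' ->
    eta (S k') (lie_bracket (xi (S j')) (xi (S i'))) = - (delta *+ 2).
  by move=> e'; rewrite (lie_anti (xi (S i'))) linearN /= br.
have br0 i' j' : eta (S i') (lie_bracket (xi (S j')) (xi (S i'))) = 0.
  by rewrite (lie_anti (xi (S i'))) linearN /= eta_lie_xi oppr0.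
have T0 Y Z : [/\ T Y Y Z = 0, T Y Z Y = 0 & T Z Y Y = 0].
  by case: Tform => _ _ _ t0; exact: t0.
have ci : eta (S i) (D X (xi (S i))) = 0.
  rewrite eta_metric metric_nabla_xi_sum big1 // => l _.
  have [_ _ t] := T0 (xi (S i)) (xi (S l)).
  by rewrite metric_nabla_xi_xi eta_lie_xi t addr0 !mulr0.
(* Among the directions xi_i, xi_j, xi_k only xi_k contributes, through eta_i([xi_j, xi_k]) = 2
   delta and T(xi_k, xi_i, xi_j) = gamma. For the xi_k component below only xi_j does, with both
   signs reversed. *)
have cj : eta (S j) (D X (xi (S i))) = lam * eta (S k) X.
  rewrite eta_metric metric_nabla_xi_sum (sum_even_triple _ e) !metric_nabla_xi_xi.
  rewrite br0 lie_self linear0 (br _ _ _ e1) (torsion_even e2).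
  have [-> _ _] := T0 (xi (S i)) (xi (S j)).
  have [_ -> _] := T0 (xi (S j)) (xi (S i)).
  by rewrite /lam; ring.
have ck : eta (S k) (D X (xi (S i))) = - (lam * eta (S j) X).
  rewrite eta_metric metric_nabla_xi_sum (sum_even_triple _ e) !metric_nabla_xi_xi.
  rewrite br0 lie_self linear0 (brN _ _ _ e1)
    (form_swap12 Tform (xi (S i)) (xi (S j))) (torsion_even e).
  have [-> _ _] := T0 (xi (S i)) (xi (S k)).
  have [_ -> _] := T0 (xi (S k)) (xi (S i)).
  by rewrite /lam; ring.
have -> : D X (xi (S i)) = vert S (D X (xi (S i))).
  by rewrite vertical_id //; exact/Dvert/vertical_xi.
rewrite /vert (sum_even_triple _ e) ci cj ck scale0r add0r.
by rewrite scalerBr !scalerA scaleNr.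
Qed.

(** The torsion T(xi_i, X, Y) compares D along xi_i with the bracket, since D_X xi_i is vertical and
    drops out. Applied to (phi X, Y) and (X, phi Y), this gives the formula for the derivative of
    phi. *)
Lemma metric_nabla_xi_field i X Y : horizontal S X -> horizontal S Y ->
  g (D (xi (S i)) X) Y = g (lie_bracket (xi (S i)) X) Y + ext_diff (eta (S i)) X Y.
Proof.
move=> hX hY; rewrite -(torsion_xi i hX hY) /T /torsion !(metricDl, metricNl).
rewrite metric_nabla_xi_horizontal //.
ring.
Qed.

End CompatibleConnections.

Theorem proposition3p2p2 (R : realType) (n : nat)
    (M : smooth_manifold R (4 * n + 3)) (g : riemannian_metric M)
    (S : 'I_3 -> almost_contact_metric g) (s : almost_contact_metric g) :
  almost_3_contact S ->
  associated_sphere S s ->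
  skew_nijenhuis_on_horizontal S s ->
  (forall i, killing g (xi (S i))) ->
  (exists D : affine_connection M, compatible_connection S s D) /\
  (forall delta : Cinf M, reeb_commutator S delta ->
   forall D : affine_connection M, compatible_connection S s D ->
   let gamma := parameter_function S D in
   (forall (X : vfield M) (i j k : 'I_3), even_triple i j k ->
      D X (xi (S i)) =
      (Cinf_const M 2^-1 * (delta *+ 2 + gamma)) *:
        (eta (S k) X *: xi (S j) - eta (S j) X *: xi (S k))) /\
   (forall (i : 'I_3) (X Y : vfield M), horizontal S X -> horizontal S Y ->
      g (nabla_endo D (xi (S i)) (phi s) X) Y =
      g (lie_endo (xi (S i)) (phi s) X) Y
      + ext_diff (eta (S i)) (phi s X) Y
      + ext_diff (eta (S i)) X (phi s Y))).
Proof.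
move=> S3 sS Ns xiK; split; first exact: compatible_connection_exists.
move=> delta Hdelta D Dcomp gamma; split=> [X i j k e|i X Y hX hY].
  exact (nabla_xi S3 xiK Dcomp Hdelta X e).
have hp := horizontal_phi_sphere S3 sS.
(* Skew-symmetry moves phi onto Y in both derivatives, so each splits into a term at (phi X, Y) and
   one at (X, phi Y), all of whose arguments are horizontal. *)
rewrite /nabla_endo /lie_endo !(metricDl, metricNl) !phi_skew !opprK.
rewrite (metric_nabla_xi_field Dcomp i (hp _ hX) hY).
rewrite (metric_nabla_xi_field Dcomp i hX (hp _ hY)).
by rewrite addrACA addrA.
Qed.
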